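(* Let $((F,\nu,N),[\,,]_{F,h},(\rho,\eta))$ be a generalized Lie algebroid with $\operatorname{rank}F=p$, and let $(E,\pi,M)$ be an interior differential system (IDS) of it, of rank $r$. Suppose $\{\Theta^{r+1},\dots,\Theta^p\}$ is a base of the $\mathcal F(M)$-submodule $(\Gamma(E^0,\pi^0,M),+,\cdot)$ of sections of the annihilator subbundle of $E$. Then the IDS $(E,\pi,M)$ is involutive if and only if there exist $$\Omega^\alpha_\beta\in\Lambda^1(h^*F,h^*\nu,M),\qquad \alpha,\beta\in\{r+1,\dots,p\},$$ such that $$d^{h^*F}\Theta^\alpha=\sum_{\beta=r+1}^{p}\Omega^\alpha_\beta\wedge\Theta^\beta,\qquad \alpha\in\{r+1,\dots,p\}.$$
   Context: Manifolds are smooth and finite-dimensional, vector bundles are real of finite rank; $\mathcal F(N)=C^\infty(N,\mathbb R)$, $\Gamma(F,\nu,N)$ is the module of smooth sections. For a vector bundle morphism $(\varphi,\varphi_0)$ with $\varphi_0$ a diffeomorphism, $\Gamma(\varphi,\varphi_0)u=\varphi\circ u\circ\varphi_0^{-1}$ on sections. Generalized Lie algebroid $((F,\nu,N),[\,,]_{F,h},(\rho,\eta))$: manifolds $M,N$, diffeomorphisms $h:M\to N$, $\eta:N\to M$, a vector bundle $(F,\nu,N)$, a vector bundle morphism $\rho:F\to TM$ covering $\eta$, and an $\mathbb R$-bilinear Lie bracket $[\,,]_{F,h}$ on $\Gamma(F,\nu,N)$ with $[u,fv]_{F,h}=f[u,v]_{F,h}+(\Gamma(Th\circ\rho,h\circ\eta)(u)f)v$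 and with $\Gamma(Th\circ\rho,h\circ\eta):\Gamma(F,\nu,N)\to\Gamma(TN,\tau_N,N)$ a Lie algebra morphism. Pull-back Lie algebroid: $(h^*F,h^*\nu,M)$ is the pull-back bundle; each of its sections is $Z=z\circ h$ (that is, $Z(x)=z(h(x))$) for a unique $z\in\Gamma(F,\nu,N)$. The bracket is $[z\circ h,w\circ h]_{h^*F}=[z,w]_{F,h}\circ h$, and the anchor $\overset{h^*F}{\rho}:h^*F\to TM$ (over $\mathrm{Id}_M$) sends $z\circ h$ to the vector field on $M$ that is $h$-related to $\Gamma(Th\circ\rho,h\circ\eta)z$; in local frames $T_\alpha=t_\alpha\circ h$ with $\rho(t_\alpha)=\sum_i\rho^i_\alpha\frac{\partial}{\partial x^i}$ and $[t_\alpha,t_\beta]_{F,h}=L^\gamma_{\alpha\beta}t_\gamma$, this reads $Z^\alpha T_\alpha\mapsto Z^\alpha(\rho^i_\alpha\circ h)\frac{\partial}{\partial x^i}$ and $[T_\alpha,T_\beta]_{h^*F}=(L^\gamma_{\alpha\beta}\circ h)T_\gamma$, extended by the Leibniz rule. This is a Lie algebroid over $M$. Forms: $\Lambda^q(h^*F,h^*\nu,M)$ is the set of alternating $\mathcal F(M)$-$q$-linear maps $\Gamma(h^*F,h^*\nu,M)^q\to\mathcal F(M)$ (so $\Lambda^1$ is the module of sections of the dual bundle $\overset{*}{h^*F}$); $(\omega\wedge\theta)(z_1,\dots,z_{q+r})=\frac1{q!r!}\sum_{\sigma}\mathrm{sgn}(\sigma)\omega(z_{\sigma(1)},\dots,z_{\sigma(q)})\theta(z_{\sigma(q+1)},\dots,z_{\sigma(q+r)})$;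 and $d^{h^*F}\omega(z_0,\dots,z_q)=\sum_i(-1)^i\,\Gamma(\overset{h^*F}{\rho},\mathrm{Id}_M)z_i(\omega(z_0,\dots,\hat z_i,\dots,z_q))+\sum_{i<j}(-1)^{i+j}\omega([z_i,z_j]_{h^*F},z_0,\dots,\hat z_i,\dots,\hat z_j,\dots,z_q)$. An interior differential system (IDS) of the generalized Lie algebroid is any vector subbundle $(E,\pi,M)$ of $(h^*F,h^*\nu,M)$. It is involutive if $[S,T]_{h^*F}\in\Gamma(E,\pi,M)$ for all $S,T\in\Gamma(E,\pi,M)$. Its annihilator subbundle $(E^0,\pi^0,M)$ of $\overset{*}{h^*F}$ has sections $\Gamma(E^0,\pi^0,M)=\{\Omega\in\Gamma(\overset{*}{h^*F},\overset{*}{h^*\nu},M):\Omega(S)=0\ \ \forall S\in\Gamma(E,\pi,M)\}$. *)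

(* Defs.v *)
From HB Require Import structures.
From mathcomp Require Import all_boot all_order all_algebra all_fingroup.
From mathcomp Require Import all_classical all_reals all_analysis.
Import Order.TTheory GRing.Theory Num.Theory numFieldNormedType.Exports.

Set Implicit Arguments.
Unset Strict Implicit.
Unset Printing Implicit Defensive.

Local Open Scope classical_set_scope.
Local Open Scope ring_scope.

Section Smooth.
Context {R : realType} {n : nat} {V : normedModType R}.

(* U is always an open set, so that only the values of f on U matter. *)
Fixpoint Ck (k : nat) (U : set 'rV[R]_n) (f : 'rV[R]_n -> V) : Prop :=
  if k is k'.+1 then
    (forall x, U x -> differentiable f x) /\
    (forall v, Ck k' U (fun x => 'D_v f x))
  else forall x, U x -> {for x, continuous f}.

Definition Cinfty (U : set 'rV[R]_n) (f : 'rV[R]_n -> V) : Prop :=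
  forall k, Ck k U f.

End Smooth.

(* Manifolds are Hausdorff and second countable, given with a smooth atlas that
   need not be maximal. cmap i and cinv i are total functions, meaningful on
   cdom i and on cmap i @` cdom i. The chart chart_at x is an arbitrary choice
   of a chart around x; it only serves to model tangent spaces. *)
Record manifold (R : realType) (m : nat) := Manifold {
  mcarrier :> topologicalType;
  mhausdorff : hausdorff_space mcarrier;
  msecond_countable : @second_countable mcarrier;
  cidx : Type;
  cdom : cidx -> set mcarrier;
  cmap : cidx -> mcarrier -> 'rV[R]_m;
  cinv : cidx -> 'rV[R]_m -> mcarrier;
  chart_at : mcarrier -> cidx;
  chart_atP : forall x, cdom (chart_at x) x;
  cdom_open : forall i, open (cdom i);
  cimg_open : forall i, open (cmap i @` cdom i);
  cmapK : forall i x, cdom i x -> cinv i (cmap i x) = x;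
  cmap_continuous : forall i x, cdom i x -> {for x, continuous (cmap i)};
  cinv_continuous : forall i a, (cmap i @` cdom i) a ->
    {for a, continuous (cinv i)};
  ctransition : forall i j,
    Cinfty (cmap i @` (cdom i `&` cdom j)) (cmap j \o cinv i)
}.
Arguments cdom {R m M} i : rename.
Arguments cmap {R m M} i x : rename.
Arguments cinv {R m M} i a : rename.
Arguments chart_at {R m M} x : rename.

Section SmoothMaps.
Context {R : realType} {m n : nat} {M : manifold R m} {N : manifold R n}.

Definition smooth_on (V : normedModType R) (U : set M) (f : M -> V) : Prop :=
  forall i : cidx M, Cinfty (cmap i @` (U `&` cdom i)) (f \o cinv i).

Definition smooth_fun (f : M -> R) : Prop := @smooth_on R^o setT f.

Definition smooth_map (f : M -> N) : Prop :=
  continuous f /\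
  forall (i : cidx M) (j : cidx N),
    Cinfty (cmap i @` (cdom i `&` f @^-1` cdom j)) (cmap j \o f \o cinv i).

End SmoothMaps.

Record bijection (A B : Type) := Bijection {
  bfun :> A -> B;
  binv : B -> A;
  bfunK : forall x, binv (bfun x) = x;
  binvK : forall y, bfun (binv y) = y
}.

Definition bijection_sym (A B : Type) (b : bijection A B) : bijection B A :=
  Bijection (binvK b) (bfunK b).

Definition bijection_comp (A B C : Type) (b : bijection A B)
    (c : bijection B C) :
    bijection A C :=
  @Bijection A C (c \o b) (binv b \o binv c)
    (fun x => etrans (congr1 (binv b) (bfunK c (b x))) (bfunK b x))
    (fun z => etrans (congr1 c (binvK b (binv c z))) (binvK c z)).

Definition diffeomorphism (R : realType) (m n : nat) (M : manifold R m)
    (N : manifold R n) (b : bijection M N) : Prop :=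
  smooth_map b /\ smooth_map (binv b).

(* A family of vector spaces with a set of candidate local trivializations;
   tmap i x and tinv i x are meaningful for x in tdom i. *)
Record prebundle (R : realType) (m : nat) (M : manifold R m) (p : nat) :=
  Prebundle {
  fib :> M -> lmodType R;
  tidx : Type;
  tdom : tidx -> set M;
  tmap : tidx -> forall x, fib x -> 'rV[R]_p;
  tinv : tidx -> forall x, 'rV[R]_p -> fib x
}.
Arguments tdom {R m M p F} i : rename.
Arguments tmap {R m M p F} i x v : rename.
Arguments tinv {R m M p F} i x a : rename.

Definition vector_bundle (R : realType) (m : nat) (M : manifold R m) (p : nat)
    (F : prebundle M p) : Prop :=
  [/\ forall i : tidx F, open (tdom i),
      forall x, exists i : tidx F, tdom i x,
      forall (i : tidx F) x, tdom i x ->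
        [/\ linear (@tmap _ _ _ _ F i x), cancel (@tmap _ _ _ _ F i x) (tinv i x)
          & cancel (tinv i x) (@tmap _ _ _ _ F i x)]
    & forall (i j : tidx F) a,
        smooth_on (tdom i `&` tdom j) (fun x => tmap j x (tinv i x a))].

(* Set-theoretic sections; the smooth ones form the module of sections. *)
Notation sect F := (forall x, fib F x).

Section Bundles.
Context {R : realType} {m n : nat} {M : manifold R m} {N : manifold R n}.

Definition smooth_sect_on (p : nat) (F : prebundle M p) (U : set M)
    (u : sect F) : Prop :=
  forall i : tidx F, smooth_on (U `&` tdom i) (fun x => tmap i x (u x)).

Definition smooth_sect (p : nat) (F : prebundle M p) (u : sect F) : Prop :=
  smooth_sect_on setT u.

Definition vb_morphism (p q : nat) (F : prebundle M p) (G : prebundle N q)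
    (phi0 : M -> N) (phi : forall x, F x -> G (phi0 x)) : Prop :=
  [/\ smooth_map phi0,
      forall x, linear (phi x)
    & forall (i : tidx F) (j : tidx G) a,
        smooth_on (tdom i `&` phi0 @^-1` tdom j)
          (fun x => tmap j (phi0 x) (phi x (tinv i x a)))].

(* Gamma(phi, phi0) u = phi \o u \o phi0^-1 *)
Definition Gamma (p q : nat) (F : prebundle M p) (G : prebundle N q)
    (phi0 : bijection M N) (phi : forall x, F x -> G (phi0 x))
    (u : sect F) : sect G :=
  fun y => eq_rect _ (fib G) (phi (binv phi0 y) (u (binv phi0 y))) y
             (binvK phi0 y).

(* The fibre over x is the fibre of F over h x. *)
Definition pullback (p : nat) (F : prebundle N p) (h : M -> N) :
    prebundle M p :=
  @Prebundle R m M p (fun x => F (h x)) (tidx F) (fun i => h @^-1` tdom i)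
    (fun i x => @tmap _ _ _ _ F i (h x)) (fun i x => tinv i (h x)).

End Bundles.

Section Tangent.
Context {R : realType}.

(* A tangent vector at x is given by its components in the chart chart_at x;
   its components in any other chart are obtained by the Jacobian of the
   transition map, which is the local trivialization of the tangent bundle over
   that chart. *)
Definition tangent (m : nat) (M : manifold R m) : prebundle M m :=
  @Prebundle R m M m (fun=> 'rV[R]_m) (cidx M) cdom
    (fun i x => 'd (cmap i \o cinv (chart_at x)) (cmap (chart_at x) x))
    (fun i x => 'd (cmap (chart_at x) \o cinv i) (cmap i x)).

Definition tangent_map (m n : nat) (M : manifold R m) (N : manifold R n)
    (h : M -> N) (x : M) : tangent M x -> tangent N (h x) :=
  'd (cmap (chart_at (h x)) \o h \o cinv (chart_at x)) (cmap (chart_at x) x).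

Definition vf_act (m : nat) (M : manifold R m) (X : sect (tangent M))
    (f : M -> R) : M -> R :=
  fun x => 'd ((f : M -> R^o) \o cinv (chart_at x)) (cmap (chart_at x) x) (X x).

End Tangent.

(* Only the values of the bracket on smooth sections are meaningful. *)
Record gen_lie_algebroid (R : realType) (m n : nat) (M : manifold R m)
    (N : manifold R n) (p : nat) := GenLieAlgebroid {
  gF : prebundle N p;
  gh : bijection M N;
  geta : bijection N M;
  grho : forall y, gF y -> tangent M (geta y);
  gbr : sect gF -> sect gF -> sect gF;
  (* Gamma(Th \o rho, h \o eta) *)
  gtheta : sect gF -> sect (tangent N) :=
    Gamma (G := tangent N) (phi0 := bijection_comp geta gh)
      (fun y v => tangent_map gh (grho v));
  gF_vb : vector_bundle gF;
  gh_diffeo : diffeomorphism gh;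
  geta_diffeo : diffeomorphism geta;
  grho_morphism : vb_morphism grho;
  gbr_smooth : forall u v, smooth_sect u -> smooth_sect v ->
    smooth_sect (gbr u v);
  gbr_linearl : forall (a : R) u v w,
    smooth_sect u -> smooth_sect v -> smooth_sect w ->
    gbr (fun y => a *: u y + v y) w = fun y => a *: gbr u w y + gbr v w y;
  gbr_linearr : forall (a : R) u v w,
    smooth_sect u -> smooth_sect v -> smooth_sect w ->
    gbr w (fun y => a *: u y + v y) = fun y => a *: gbr w u y + gbr w v y;
  gbr_alternating : forall u, smooth_sect u -> gbr u u = fun=> 0;
  gbr_jacobi : forall u v w,
    smooth_sect u -> smooth_sect v -> smooth_sect w -> forall y,
    gbr u (gbr v w) y + gbr v (gbr w u) y + gbr w (gbr u v) y = 0;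
  gbr_leibniz : forall (f : N -> R) u v,
    smooth_fun f -> smooth_sect u -> smooth_sect v ->
    gbr u (fun y => f y *: v y) =
      fun y => f y *: gbr u v y + vf_act (gtheta u) f y *: v y;
  (* gtheta (gbr u v) is the Lie bracket of the vector fields gtheta u and
     gtheta v. *)
  gtheta_morphism : forall u v (f : N -> R),
    smooth_sect u -> smooth_sect v -> smooth_fun f ->
    vf_act (gtheta (gbr u v)) f =
      fun y => vf_act (gtheta u) (vf_act (gtheta v) f) y
               - vf_act (gtheta v) (vf_act (gtheta u) f) y
}.

Section PullbackAlgebroid.
Context {R : realType} {m n p : nat} {M : manifold R m} {N : manifold R n}.
Variable A : gen_lie_algebroid M N p.

Definition hF : prebundle M p := pullback (gF A) (gh A).

(* The section z of F such that Z = z \o h. *)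
Definition hdesc (Z : sect hF) : sect (gF A) :=
  Gamma (F := hF) (phi0 := gh A) (fun x v => v) Z.

Definition hbr (Z W : sect hF) : sect hF :=
  fun x => gbr (hdesc Z) (hdesc W) (gh A x).

(* The anchor on sections: the image of gtheta z under (T(h^-1), h^-1), that is,
   the vector field on M which is h-related to gtheta z. *)
Definition hanchor (Z : sect hF) : sect (tangent M) :=
  Gamma (G := tangent M) (phi0 := bijection_sym (gh A))
    (fun y v => tangent_map (bijection_sym (gh A)) v) (gtheta (hdesc Z)).

End PullbackAlgebroid.

Section Forms.
Context {R : realType} {m : nat} {M : manifold R m} {p : nat}.
Variable F : prebundle M p.

(* Forms are meaningful on smooth sections only, hence form_eq. *)
Definition lform (q : nat) : Type := ('I_q -> sect F) -> M -> R.

Definition form_eq (q : nat) (w t : lform q) : Prop :=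
  forall z, (forall i, smooth_sect (z i)) -> w z = t z.

Definition is_form (q : nat) (w : lform q) : Prop :=
  [/\ forall z, (forall i, smooth_sect (z i)) -> smooth_fun (w z),
      forall z k (f g : M -> R) (u v : sect F),
        (forall i, smooth_sect (z i)) -> smooth_fun f -> smooth_fun g ->
        smooth_sect u -> smooth_sect v ->
        w [eta z with k |-> (fun x => f x *: u x + g x *: v x)] =
        fun x => f x * w [eta z with k |-> u] x + g x * w [eta z with k |-> v] x
    & forall z i j, (forall k, smooth_sect (z k)) -> i != j -> z i = z j ->
        w z = fun=> 0].

Definition wedge_form (q r : nat) (w : lform q) (t : lform r) :
    lform (q + r) :=
  fun z x => (q`!%:R * r`!%:R)^-1 *
    \sum_(s : 'S_(q + r)) (-1) ^+ s *
      (w (fun i => z (s (lshift r i))) x * t (fun j => z (s (rshift q j))) x).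

Definition form_comb (q k : nat) (f : 'I_k -> M -> R) (w : 'I_k -> lform q) :
    lform q :=
  fun z x => \sum_(a < k) f a x * w a z x.

(* T is a base of the module of forms w such that P w. *)
Definition form_base (q : nat) (P : lform q -> Prop) (k : nat)
    (T : 'I_k -> lform q) : Prop :=
  [/\ forall a, P (T a),
      forall w, P w -> exists2 f : 'I_k -> M -> R,
        forall a, smooth_fun (f a) & form_eq w (form_comb f T)
    & forall f : 'I_k -> M -> R, (forall a, smooth_fun (f a)) ->
        form_eq (form_comb f T) (fun _ _ => 0) -> forall a, f a = fun=> 0].

(* E x is a subspace of F x, and E has a smooth local frame of r sections around
   every point. *)
Definition subbundle (r : nat) (E : forall x, set (F x)) : Prop :=
  forall x, exists (U : set M) (s : 'I_r -> sect F),
    [/\ open U, U x, forall i, smooth_sect_on U (s i),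
        forall y, U y -> forall a : 'rV[R]_r,
          \sum_(i < r) a 0 i *: s i y = 0 -> a = 0
      & forall y, U y -> forall v, E y v <->
          exists a : 'rV[R]_r, v = \sum_(i < r) a 0 i *: s i y].

Definition sub_sect (E : forall x, set (F x)) (S : sect F) : Prop :=
  smooth_sect S /\ forall x, E x (S x).

Definition annihilator (E : forall x, set (F x)) (w : lform 1) : Prop :=
  is_form w /\ forall S, sub_sect E S -> w (fun=> S) = fun=> 0.

End Forms.

Section IDS.
Context {R : realType} {m n p : nat} {M : manifold R m} {N : manifold R n}.
Variable A : gen_lie_algebroid M N p.

(* For i < j, the map k |-> bump j (bump i k) enumerates the indices other than
   i and j. *)
Definition ext_d (q : nat) (w : lform (hF A) q) : lform (hF A) q.+1 :=
  fun z x =>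
    \sum_(i < q.+1) (-1) ^+ i *
      vf_act (hanchor (z i)) (w (fun k => z (lift i k))) x +
    \sum_(i < q.+1) \sum_(j < q.+1 | (i < j)%N) (-1) ^+ (i + j) *
      w (fun k : 'I_q => if (k == 0 :> nat)%N then hbr (z i) (z j)
                         else z (inord (bump j (bump i k.-1)))) x.

Definition involutive_ids (E : forall x, set (hF A x)) : Prop :=
  forall S T, sub_sect E S -> sub_sect E T -> sub_sect E (hbr S T).

End IDS.

(* Main.v *)
Require Import Defs.
From HB Require Import structures.
From mathcomp Require Import all_boot all_order all_algebra all_fingroup.
From mathcomp Require Import all_classical all_reals all_analysis.
From mathcomp Require Import ring lra.
Import Order.TTheory GRing.Theory Num.Theory numFieldNormedType.Exports.

(* If E is involutive, [d Theta^a] vanishes on E. There are sections z_b with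
   [Theta^a(z_b) = delta_ab], so that [Z |-> Z - sum_b Theta^b(Z) z_b] projects
   onto E; expanding [d Theta^a] along this splitting shows that
   [Omega^a_b(Z) = (d Theta^a)(Z - 1/2 sum_c Theta^c(Z) z_c, z_b)] solves the
   structure equations. Conversely, on sections S, T of E both sides of the
   equations reduce to [Theta^a([S, T]) = 0], and a section killed by all the
   Theta^a lies in E: they generate the annihilator of E, which has enough
   global sections to detect every vector outside E.
   The z_b exist locally since the Theta^a, which generate the annihilator of
   E, are independent at every point; they are glued with bump functions.
   That the anchor is linear over functions on M is not an axiom: a priori it
   only satisfies [rho(f Z) = (f o tau) rho(Z)] for a diffeomorphism tau of M,
   but [[f Z, f Z] = 0] forces the anchor to vanish where tau is not the
   identity. *)

Set Implicit Arguments.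
Unset Strict Implicit.
Unset Printing Implicit Defensive.

Local Open Scope classical_set_scope.
Local Open Scope ring_scope.

(** * Calculus in Euclidean space *)

Section EuclideanCalculus.
Context {R : realType}.

(** The remainder estimate at [a] involves only values near [a], so the first-order expansion of [f]
    is also one of [g], and differentials are unique. Inverse charts are meaningful on open images
    only, hence the need to argue with germs. *)
Lemma near_eq_differentiable (V W : normedModType R) (f g : V -> W) a :
  (\near a, f a = g a) -> differentiable f a ->
  differentiable g a /\ 'd g a = 'd f a :> (V -> W).
Proof.
move=> fg df.
have dl : continuous ('d f a) /\
    g \o shift a = cst (g a) + 'd f a +o_ 0 id.
  split; first exact: diff_continuous.
  apply/eqaddoP => e e0.
  have fg0 : \forall h \near (0 : V), f (h + a) = g (h + a).
    move: fg; rewrite (near_shift (0 : V)); apply: filterS => h.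
    by rewrite /= subr0.
  have fga : f a = g a by rewrite (nbhs_singleton fg).
  apply: filterS2 fg0 ((eqaddoP _ _ _ _).1 (diff_locally df) e e0) => h.
  by rewrite !fctE /= fga => ->.
have -> := diff_unique dl.1 dl.2; split=> //.
by apply/diff_locallyP; rewrite (diff_unique dl.1 dl.2).
Unshelve. all: by end_near. Qed.

Section OneDomain.
Context {n : nat}.
Implicit Types (U : set 'rV[R]_n) (V W : normedModType R).

Lemma open_near_eq U (T : Type) (f g : 'rV[R]_n -> T) x :
  open U -> U x -> (forall y, U y -> f y = g y) -> \near x, f x = g x.
Proof. by move=> oU Ux fg; near=> y; apply: fg; near: y; exact: open_nbhs_nbhs. 
Unshelve. all: by end_near. Qed.

Lemma Ck_ext V k U (f g : 'rV[R]_n -> V) :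
  open U -> (forall x, U x -> f x = g x) -> Ck k U f -> Ck k U g.
Proof.
move=> oU; elim: k f g => [|k IH] f g fg /=.
  move=> cf x Ux; have nfg := open_near_eq oU Ux fg.
  change (g @ x --> g x); rewrite -(fg x Ux).
  exact: cvg_trans (near_eq_cvg (F := nbhs x) nfg) (cf x Ux).
move=> [df Cf]; split=> [x Ux|v].
  exact: (near_eq_differentiable (open_near_eq oU Ux fg) (df x Ux)).1.
apply: IH (Cf v) => x Ux.
exact: near_eq_derive (open_near_eq oU Ux fg).
Qed.

Lemma Ck_sub V k U U' (f : 'rV[R]_n -> V) : U' `<=` U -> Ck k U f -> Ck k U' f.
Proof.
move=> sU; elim: k f => [|k IH] f /=; first by move=> cf x /sU /cf.
by move=> [df Cf]; split=> [x /sU /df//|v]; exact: IH.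
Qed.

(** [U'] may be any set containing [x]: [Ck] is a conjunction of conditions at the points of the
    set, with derivatives taken in the whole space. *)
Lemma Ck_pointwise V k U (f : 'rV[R]_n -> V) :
  (forall x, U x -> exists2 U', U' x & Ck k U' f) -> Ck k U f.
Proof.
elim: k f => [|k IH] f /= H.
  by move=> x /H [U' U'x]; apply.
split=> [x /H [U' U'x []] /(_ _ U'x)//|v].
by apply: IH => x /H [U' U'x [_ Cf]]; exists U'.
Qed.

Lemma CkS V k U (f : 'rV[R]_n -> V) : Ck k.+1 U f -> Ck k U f.
Proof.
elim: k f => [|k IH] f /=.
  by move=> [df _] x Ux; exact/differentiable_continuous/df.
by move=> [df Cf]; split=> // v; exact/IH/Cf.
Qed.

Lemma Ck_cst V k U (c : V) : Ck k U (cst c).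
Proof.
elim: k c => [|k IH] c /=; first by move=> x _; exact: cst_continuous.
split=> [x _|v]; first exact: differentiable_cst.
have -> : (fun x => 'D_v (cst c : 'rV[R]_n -> V) x) = cst 0.
  by apply/funext => x; exact: derive_cst.
exact: IH.
Qed.

Lemma Ck_add V k U (f g : 'rV[R]_n -> V) :
  open U -> Ck k U f -> Ck k U g -> Ck k U (fun x => f x + g x).
Proof.
move=> oU; elim: k f g => [|k IH] f g /=.
  by move=> cf cg x Ux; apply: continuousD; [exact: cf|exact: cg].
move=> Cf Cg; split=> [x Ux|v].
  by apply: differentiableD; [exact: Cf.1|exact: Cg.1].
apply: (Ck_ext oU _ (IH _ _ (Cf.2 v) (Cg.2 v))) => x Ux.
by rewrite -deriveD//; apply: diff_derivable; [exact: Cf.1|exact: Cg.1].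
Qed.

Lemma Ck_linear V W k U (f : 'rV[R]_n -> V) (L : {linear V -> W}) :
  open U -> continuous L -> Ck k U f -> Ck k U (L \o f).
Proof.
move=> oU cL.
have dL y : differentiable L y by apply: linear_differentiable.
elim: k f => [|k IH] f /=.
  by move=> cf x Ux; apply: continuous_comp; [exact: cf|exact: cL].
move=> Cf; split=> [x Ux|v].
  exact: differentiable_comp (Cf.1 x Ux) (dL _).
apply: (Ck_ext oU _ (IH _ (Cf.2 v))) => x Ux /=.
have dfx := Cf.1 x Ux.
rewrite [in RHS]deriveE; last exact: differentiable_comp.
by rewrite diff_comp //= diff_lin // deriveE.
Qed.

Lemma Ck_mul k U (f g : 'rV[R]_n -> R^o) :
  open U -> Ck k U f -> Ck k U g -> Ck (V:=R^o) k U (fun x => f x * g x).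
Proof.
move=> oU; elim: k f g => [|k IH] f g.
  by move=> cf cg x Ux; apply: continuousM; [exact: cf|exact: cg].
move=> Cf Cg; split=> [x Ux|v].
  by apply: differentiableM; [exact: Cf.1|exact: Cg.1].
have := Ck_add oU (IH _ _ (CkS Cf) (Cg.2 v)) (IH _ _ (CkS Cg) (Cf.2 v)).
apply: (Ck_ext oU) => x Ux.
by rewrite -[RHS]/('D_v (f * g) x) deriveM//;
  apply: diff_derivable; [exact: Cf.1|exact: Cg.1].
Qed.

(** The derivative [- f^-2 * 'D_v f] involves the inverse itself one degree lower, so induction
    applies. *)
Lemma Ck_inv k U (f : 'rV[R]_n -> R^o) :
  open U -> (forall x, U x -> f x != 0) -> Ck k U f ->
  Ck (V:=R^o) k U (fun x => (f x)^-1).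
Proof.
move=> oU f0; elim: k => [|k IH].
  by move=> cf x Ux; apply: continuousV; [exact: f0|exact: cf].
move=> Cf; split=> [x Ux|v].
  by apply: differentiableV; [exact: Cf.1|exact: f0].
have CI := IH (CkS Cf).
have := Ck_mul oU (Ck_cst k U (-1 : R^o)) (Ck_mul oU (Ck_mul oU CI CI) (Cf.2 v)).
apply: (Ck_ext oU) => x Ux; rewrite deriveV; [|exact: f0|exact/diff_derivable/(Cf.1 x Ux)].
by rewrite /cst /= mulN1r -expr2 exprVn -mulNr.
Qed.

End OneDomain.

Lemma Ck_coord n m k (U : set 'rV[R]_n) (f : 'rV[R]_n -> 'rV[R]_m) j :
  open U -> Ck k U f -> Ck (V:=R^o) k U (fun x => f x 0 j).
Proof.
move=> oU.
have lj : linear (fun v : 'rV[R]_m => v 0 j : R^o).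
  by move=> a u v; rewrite !mxE.
pose Lm := GRing.isLinear.Build _ _ _ _ _ lj.
pose Lj : {linear 'rV[R]_m -> R^o} := HB.pack (fun v : 'rV[R]_m => v 0 j : R^o) Lm.
apply: (@Ck_linear _ _ _ _ _ _ Lj) => //; exact: coord_continuous.
Qed.

Lemma Ck_sum n (V : normedModType R) (I : Type) (s : seq I)
    (P : pred I) k (U : set 'rV[R]_n) (f : I -> 'rV[R]_n -> V) : open U ->
  (forall i, P i -> Ck k U (f i)) -> Ck k U (fun x => \sum_(i <- s | P i) f i x).
Proof.
move=> oU Cf; elim: s => [|i s IH].
  by apply: (Ck_ext oU _ (Ck_cst k U 0)) => x _; rewrite big_nil.
case Pi : (P i); last by apply: (Ck_ext oU _ IH) => x _; rewrite big_cons Pi.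
by apply: (Ck_ext oU _ (Ck_add oU (Cf _ Pi) IH)) => x _; rewrite big_cons Pi.
Qed.

Lemma Ck_rowP n m k (U : set 'rV[R]_n) (f : 'rV[R]_n -> 'rV[R]_m) :
  open U -> (forall j, Ck (V:=R^o) k U (fun x => f x 0 j)) -> Ck k U f.
Proof.
move=> oU Cf.
have Cj j : Ck k U (fun x => (f x 0 j) *: (delta_mx 0 j : 'rV[R]_m)).
  have ld : linear (fun t : R^o => t *: (delta_mx 0 j : 'rV[R]_m)).
    by move=> a s t; rewrite scalerDl scalerA.
  pose Lm := GRing.isLinear.Build _ _ _ _ _ ld.
  pose Lj : {linear R^o -> 'rV[R]_m} :=
    HB.pack (fun t : R^o => t *: (delta_mx 0 j : 'rV[R]_m)) Lm.
  apply: (@Ck_linear _ _ _ _ _ _ Lj) (Cf j) => //; exact: scalel_continuous.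
have CS := @Ck_sum _ _ _ (index_enum 'I_m) xpredT k U _ oU (fun j _ => Cj j).
apply: (Ck_ext oU _ CS) => x _.
by rewrite [RHS]row_sum_delta.
Qed.

(* The directional derivative of [phi \o G] is the sum of the partial
   derivatives of [phi], composed with [G], times the components of that of
   [G]; all of these are one degree less smooth, so induction applies. *)
Lemma Ck_comp n m k (U : set 'rV[R]_n) (W : set 'rV[R]_m)
    (G : 'rV[R]_n -> 'rV[R]_m) (phi : 'rV[R]_m -> R^o) :
  open U -> (forall x, U x -> W (G x)) -> Ck k U G -> Ck k W phi ->
  Ck (V:=R^o) k U (phi \o G).
Proof.
move=> oU UW; elim: k phi => [|k IH] phi.
  by move=> cG cphi x Ux; apply: continuous_comp; [exact: cG|exact/cphi/UW].
move=> CG Cphi; have dG x Ux := CG.1 x Ux.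
have dphi x Ux := Cphi.1 _ (UW x Ux).
split=> [x Ux|v]; first by exact: differentiable_comp (dG x Ux) (dphi x Ux).
have Cj (j : 'I_m) : Ck (V:=R^o) k U
    (fun x => ('D_v G x) 0 j * 'D_(delta_mx 0 j) phi (G x)).
  apply: Ck_mul => //; first exact: Ck_coord (CG.2 v).
  exact: IH (CkS CG) (Cphi.2 _).
have CS := @Ck_sum _ _ _ (index_enum 'I_m) xpredT k U _ oU (fun j _ => Cj j).
apply: (Ck_ext oU _ CS) => x Ux /=.
rewrite [RHS]deriveE; last by exact: differentiable_comp (dG x Ux) (dphi x Ux).
rewrite (diff_comp (dG x Ux) (dphi x Ux)).
rewrite /= -(deriveE _ (dG x Ux)).
rewrite [in RHS](row_sum_delta ('D_v G x)) linear_sum; apply: eq_bigr => j _.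
by rewrite linearZ /= (deriveE _ (dphi x Ux)).
Qed.

End EuclideanCalculus.

(** * Bump functions in Euclidean space *)

Section BumpFunction.
Context {R : realType}.

(** The classical function [exp(-1/t)] extended by 0, times powers of [1/t]; the index [q] makes the
    family stable under differentiation up to linear combinations. *)
Definition flat (q : nat) (t : R) : R :=
  if 0 < t then t^-1 ^+ q * expR (- t^-1) else 0.

Lemma flat_gt0 t : 0 < t -> 0 < flat 0 t.
Proof. by move=> t0; rewrite /flat t0 expr0 mul1r expR_gt0. Qed.

Lemma flat_le0 q t : t <= 0 -> flat q t = 0.
Proof. by rewrite /flat leNgt => /negbTE ->. Qed.

(** With [s = 1/t], this is [s^(q+1) / (q+1)! <= exp s]. It controls the difference quotients at
    0. *)
Lemma flat_bound q t : `|flat q t| <= q.+1`!%:R * `|t|.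
Proof.
rewrite /flat; case: ltP => t0; last by rewrite normr0 mulr_ge0.
have s0 : 0 < t^-1 by rewrite invr_gt0.
rewrite (gtr0_norm t0) ger0_norm; last by rewrite mulr_ge0 ?expR_ge0 ?exprn_ge0 ?ltW.
have f0 : 0 < q.+1`!%:R :> R by rewrite ltr0n fact_gt0.
rewrite expRN ler_pdivrMr ?expR_gt0 // -mulrA -ler_pdivrMl //.
rewrite -(ler_pM2l s0) mulKf ?gt_eqF // mulrCA -exprS mulrC.
by apply: le_trans (expR_ge1Dxn q (ltW s0)); rewrite lerDr.
Qed.

Lemma is_derive_flat (q : nat) (t : R) :
  is_derive t (1 : R) (flat q : R -> R^o) (flat q.+2 t - q%:R * flat q.+1 t).
Proof.
have [t0|t0|<-] := ltgtP 0 t.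
- have eqf : \near t, t^-1 ^+ q * expR (- t^-1) = flat q t.
    near=> y; have y0 : 0 < y by near: y; exact: lt_nbhsr.
    by rewrite /flat y0.
  apply: (near_eq_is_derive eqf).
  have iv : is_derive t 1 (fun y : R => y^-1 : R^o) (- t ^- 2 *: (1 : R)).
    by apply: is_deriveV; rewrite ?gt_eqF.
  have ie : is_derive t 1 ((expR : R -> R) \o (fun y => - y^-1))
      (expR (- t^-1) * (- (- t ^- 2 *: (1 : R)))).
    exact: is_derive1_comp.
  have -> : (fun t : R => t^-1 ^+ q * expR (- t^-1)) =
      ((fun t : R => t^-1) ^+ q) * ((expR : R -> R) \o (fun y => - y^-1)).
    by apply/funext => y; rewrite mulrfctE exprfctE.
  apply: (is_derive_eq (is_deriveM (is_deriveX q iv) ie)).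
  rewrite exprfctE /flat t0 /GRing.scale /= !mulr1 opprK -!exprVn.
  case: q {eqf} => [|q] /=; first by rewrite mul0r mul0r mulr0; ring.
  by rewrite !exprS; ring.
- rewrite !flat_le0 ?(ltW t0) // mulr0 subr0.
  have eqf : \near t, 0 = flat q t.
    near=> y; rewrite flat_le0 // ltW //; near: y; exact: lt_nbhsl.
  apply: (near_eq_is_derive eqf); exact: is_derive_cst.
- rewrite !flat_le0 // mulr0 subr0.
  (* The quotient [flat q h / h] is [flat q.+1 h], which tends to 0 by [flat_bound]. *)
  have cv : h^-1 *: ((flat q : R -> R^o) (h *: (1 : R) + 0) - flat q 0) @[h --> 0^']
      --> (0 : R^o).
    rewrite (flat_le0 q (lexx 0)).
    apply/cvgrPdist_lt => e e0.
    have f0 : 0 < q.+2`!%:R :> R by rewrite ltr0n fact_gt0.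
    near=> h.
    have h0 : h != 0 by near: h; exact: nbhs_dnbhs_neq.
    rewrite subr0 sub0r normrN addr0 [h *: 1]mulr1.
    have -> : h^-1 *: (flat q h : R^o) = flat q.+1 h.
      rewrite /flat; case: ifP => _; last by rewrite scaler0.
      by rewrite exprS -[RHS]mulrA.
    apply: le_lt_trans (flat_bound _ _) _.
    rewrite -ltr_pdivlMl //; near: h; apply: dnbhs0_lt.
    by rewrite mulr_gt0 // invr_gt0.
  apply: DeriveDef; first by apply/cvg_ex; exists 0.
  exact: cvg_lim cv.
Unshelve. all: by end_near. Qed.

(** Induction on [k] for all [q] at once, since the derivative involves the indices [q.+1] and
    [q.+2]. *)
Lemma Ck_flat n k q (U : set 'rV[R]_n) (f : 'rV[R]_n -> R^o) :
  open U -> Ck k U f -> Ck (V:=R^o) k U (flat q \o f).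
Proof.
move=> oU; have dF p t : differentiable (flat p : R -> R^o) t.
  by apply/derivable1_diffP; case: (is_derive_flat p t).
elim: k q => [|k IH] q.
  move=> cf x Ux; apply: continuous_comp; first exact: cf.
  exact/differentiable_continuous/dF.
move=> Cf; have Cg := IH _ (CkS Cf); split=> [x Ux|v].
  exact: differentiable_comp (Cf.1 x Ux) (dF _ _).
have := Ck_mul oU (Cf.2 v)
  (Ck_add oU (Cg q.+2) (Ck_mul oU (Ck_cst k U (- q%:R : R^o)) (Cg q.+1))).
apply: (Ck_ext oU) => x Ux.
rewrite [RHS]deriveE; last exact: differentiable_comp (Cf.1 x Ux) (dF _ _).
rewrite (diff_comp (Cf.1 x Ux) (dF _ _)) /= -(deriveE _ (Cf.1 x Ux)).
have dv : 'd (flat q : R -> R^o) (f x) 1 = flat q.+2 (f x) - q%:R * flat q.+1 (f x).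
  by rewrite -deriveE //; case: (is_derive_flat q (f x)).
rewrite -[X in 'd _ _ X]mulr1 [_ * 1]/(_ *: (1 : R^o)) linearZ /= dv.
by rewrite /cst mulNr.
Qed.

Lemma euclidean_bump n (U : set 'rV[R]_n) c : open U -> U c ->
  exists chi : 'rV[R]_n -> R^o, exists K : set 'rV[R]_n,
    [/\ Cinfty setT chi, compact K, K `<=` U, forall a, ~ K a -> chi a = 0
      & \near c, chi c = 1].
Proof.
move=> oU Uc.
have [e e0 eU] : exists2 e : R, 0 < e & ball c e `<=` U.
  by apply/nbhs_ballP; exact: open_nbhs_nbhs.
(* [s] is the squared Euclidean distance to [c], whereas balls and the cube [K] refer to the sup
   norm. The function [chi] below is 1 where [s <= d] and 0 where [s >= 2 d = rho^2], in particular
   outside the cube of half-side [rho < e]. *)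
pose s (a : 'rV[R]_n) : R^o := \sum_(j < n) (a 0 j - c 0 j) * (a 0 j - c 0 j).
pose rho := e / 2; have rho0 : 0 < rho by rewrite divr_gt0.
pose d := rho ^+ 2 / 2; have d0 : 0 < d by rewrite divr_gt0 // exprn_gt0.
have oT := @openT 'rV[R]_n.
have Cs k : Ck k setT s.
  apply: (Ck_sum (V := R^o)) => // j _.
  have Cj : Ck (V:=R^o) k setT (fun a : 'rV[R]_n => a 0 j - c 0 j).
    apply: (Ck_add (V:=R^o)) => //; last exact: Ck_cst.
    apply: Ck_coord => //; elim: k => [|k IH]; first by move=> x _; exact: cvg_id.
    split=> [x _|v]; first by case: (is_diff_id x).
    have -> : (fun x => 'D_v (id : 'rV[R]_n -> 'rV[R]_n) x) = cst v.
      by apply/funext => x; exact: derive_id.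
    exact: Ck_cst.
  exact: Ck_mul.
pose u (a : 'rV[R]_n) : R^o := d * 2 - s a; pose w (a : 'rV[R]_n) : R^o := s a - d.
have Cu k : Ck k setT u.
  apply: (Ck_ext oT _ (Ck_add oT (Ck_cst k setT (d * 2 : R^o))
    (Ck_mul oT (Ck_cst k setT (-1 : R^o)) (Cs k)))) => x _.
  by rewrite /cst mulN1r.
have Cw k : Ck k setT w.
  by apply: (Ck_add (V:=R^o)) => //; exact: Ck_cst.
(* Since [u + w = d > 0], at least one of the two arguments is positive. *)
have den0 a : 0 < flat 0 (u a) + flat 0 (w a).
  have ge0 t : 0 <= flat 0 t.
    by case: (ltP 0 t) => [/flat_gt0/ltW//|/(flat_le0 0)->].
  have [ua|ua] := ltP 0 (u a).
    by rewrite ltr_wpDr // flat_gt0.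
  rewrite ltr_wpDl // flat_gt0 // /w; move: ua; rewrite /u.
  by move: (s a) => t; lra.
pose chi a : R^o := flat 0 (u a) * (flat 0 (u a) + flat 0 (w a))^-1.
pose K := [set a : 'rV[R]_n | forall j, a ord0 j \in `[c 0 j - rho, c 0 j + rho]].
exists chi, K; split.
- move=> k; apply: Ck_mul => //; first exact: Ck_flat.
  apply: Ck_inv => //; first by move=> x _; rewrite gt_eqF.
  by apply: (Ck_add (V:=R^o)) => //; exact: Ck_flat.
- apply: (@rV_compact _ _ (fun j => `[c 0 j - rho, c 0 j + rho]%classic)) => j.
  exact: segment_compact.
- move=> a Ka; apply: eU; rewrite -ball_normE /=.
  rewrite [X in X < _]/Num.Def.normr /= mx_normrE; apply: bigmax_lt => // -[i j] _ /=.
  rewrite (ord1 i) !mxE; have := Ka j; rewrite in_itv /= => /andP[h1 h2].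
  apply: (@le_lt_trans _ _ rho); last by rewrite /rho ltr_pdivrMr // ltr_pMr // ltr1n.
  by rewrite ler_norml; lra.
- move=> a Ka; rewrite /chi flat_le0 ?mul0r //.
  have [j hj] : exists j, ~~ (a ord0 j \in `[c 0 j - rho, c 0 j + rho]).
    by apply/existsP; rewrite -negb_forall; apply/negP => /forallP.
  have sj : rho ^+ 2 <= s a.
    rewrite /s (bigD1 j) //=; apply: ler_wpDr.
      by apply: sumr_ge0 => i _; rewrite -expr2 sqr_ge0.
    move: hj; rewrite in_itv /= negb_and -!ltNge => /orP[] h.
      by nra.
    by nra.
  by rewrite /u /d; lra.
- have s0 : s c = 0 by rewrite /s big1 // => j _; rewrite subrr mulr0.
  have cs : {for c, continuous s} by exact: (Cs 0%N).
  near=> a.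
  have sa : s a < d.
    near: a; apply: (cs [set t | t < d]); apply: lt_nbhsl; by rewrite s0.
  rewrite /chi (@flat_le0 0 (w a)) ?addr0 ?divff //.
    by rewrite gt_eqF // flat_gt0 // /u; lra.
  by rewrite /w subr_le0 ltW.
Unshelve. all: by end_near. Qed.

End BumpFunction.

(** * Smooth functions on manifolds *)

Section ManifoldCalculus.
Context {R : realType}.

Lemma nbhs_open (T : topologicalType) (x : T) (P : set T) :
  nbhs x P -> exists W, [/\ open W, W x & W `<=` P].
Proof. by rewrite nbhsE => -[W [oW Wx] WP]; exists W. Qed.

(** The image is the part of the open chart image that the continuous inverse chart sends into
    [V]. *)
Lemma open_chart_image m (M : manifold R m) (i : cidx M) (V : set M) :
  open V -> open (cmap i @` (V `&` cdom i)).
Proof.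
move=> oV; rewrite openE => _ [x [Vx ix] <-].
have Ox : (cmap i @` cdom i) (cmap i x) by exists x.
have c := cinv_continuous Ox.
have VK : nbhs (cinv i (cmap i x)) V by rewrite cmapK //; exact: open_nbhs_nbhs.
have nO : \forall a \near cmap i x, (cmap i @` cdom i) a.
  by apply: open_nbhs_nbhs; split => //; exact: cimg_open.
apply: filterS2 nO (c _ VK) => _ [y iy <-] /=; rewrite cmapK // => Vy.
by exists y.
Qed.

(** Smoothness of a germ, tested in a single chart; transition maps carry it to all others. Gluing
    and cutting off are then checked one point at a time. *)
Definition smooth_at m (M : manifold R m) (x : M) (f : M -> R) : Prop :=
  exists (i : cidx M) (V : set M), [/\ open V, V x, cdom i x
    & Cinfty (V := R^o) (cmap i @` (V `&` cdom i)) (f \o cinv i)].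

Lemma Cinfty_comp_on n k (U : set 'rV[R]_n) (W : set 'rV[R]_k)
    (G : 'rV[R]_n -> 'rV[R]_k) (phi : 'rV[R]_k -> R^o) (psi : 'rV[R]_n -> R^o) :
  open U -> (forall x, U x -> W (G x) /\ phi (G x) = psi x) ->
  Cinfty U G -> Cinfty W phi -> Cinfty U psi.
Proof.
move=> oU UW CG Cphi l; apply: (Ck_ext oU _ (Ck_comp oU _ (CG l) (Cphi l))).
  by move=> x /UW[].
by move=> x /UW[].
Qed.

Section OneManifold.
Context {m : nat} {M : manifold R m}.
Implicit Types (x : M) (f g : M -> R) (U V : set M).

Lemma smooth_at_chart x f (j : cidx M) : smooth_at x f -> cdom j x ->
  exists V, [/\ open V, V x
    & Cinfty (V := R^o) (cmap j @` (V `&` cdom j)) (f \o cinv j)].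
Proof.
move=> [i [V [oV Vx ix Cf]]] jx.
have oVi : open (V `&` cdom i) by apply: openI => //; exact: cdom_open.
exists (V `&` cdom i); split=> //.
apply: (Cinfty_comp_on (open_chart_image oVi) _ _ Cf (G := cmap i \o cinv j)).
  move=> _ [y [[Vy iy] jy] <-] /=; rewrite cmapK //; split; first by exists y.
  by rewrite cmapK.
move=> k; apply: Ck_sub (ctransition j i k) => _ [y [[Vy iy] jy] <-].
by exists y.
Qed.

Lemma smooth_onP U f : open U ->
  smooth_on (V := R^o) U f <-> forall x, U x -> smooth_at x f.
Proof.
move=> oU; split=> [Cf x Ux|Cf i k].
  by exists (chart_at x), U; split=> //; exact: chart_atP.
apply: Ck_pointwise => _ [x [Ux ix] <-].
have [V [oV Vx CV]] := smooth_at_chart (Cf x Ux) ix.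
by exists (cmap i @` (V `&` cdom i)); [exists x|exact: CV].
Qed.

Lemma smooth_funP f : smooth_fun f <-> forall x, smooth_at x f.
Proof.
split=> [/(smooth_onP _ openT) Cf x|Cf]; first exact: Cf.
by apply/(smooth_onP _ openT) => x _; exact: Cf.
Qed.

Lemma smooth_on_rowP U p (f : M -> 'rV[R]_p) : open U ->
  smooth_on U f <-> forall j x, U x -> smooth_at x (fun y => f y 0 j).
Proof.
move=> oU; split=> [Cf j|Cf i k].
  apply/(smooth_onP _ oU) => i k.
  exact: (Ck_coord (f := f \o cinv i)) (open_chart_image oU) (Cf i k).
apply: Ck_rowP; first exact: open_chart_image.
by move=> j; have /(smooth_onP _ oU) := Cf j; apply.
Qed.

Lemma smooth_at_near x f g : (\near x, f x = g x) -> smooth_at x f ->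
  smooth_at x g.
Proof.
move=> /nbhs_open[W [oW Wx fg]] [i [V [oV Vx ix Cf]]].
have oVW : open (V `&` W) by exact: openI.
exists i, (V `&` W); split=> // k.
apply: (Ck_ext (open_chart_image oVW) _ (Ck_sub _ (Cf k))).
  by move=> _ [y [[Vy Wy] iy] <-] /=; rewrite cmapK //; exact: fg.
by move=> _ [y [[Vy Wy] iy] <-]; exists y.
Qed.

Lemma smooth_at_cst x c : smooth_at x (cst c).
Proof.
exists (chart_at x), setT; split=> //; [exact: openT|exact: chart_atP|].
by move=> k; exact: (Ck_cst k _ (c : R^o)).
Qed.

Lemma smooth_at2 x f g (op : R -> R -> R) :
  (forall k (U : set 'rV[R]_m) (u v : 'rV[R]_m -> R^o), open U ->
    Ck k U u -> Ck k U v -> Ck (V := R^o) k U (fun a => op (u a) (v a))) ->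
  smooth_at x f -> smooth_at x g -> smooth_at x (fun y => op (f y) (g y)).
Proof.
move=> Cop [i [V [oV Vx ix Cf]]] Sg.
have [V' [oV' V'x Cg]] := smooth_at_chart Sg ix.
have oVV : open (V `&` V') by exact: openI.
exists i, (V `&` V'); split=> // k.
apply: Cop (open_chart_image oVV) (Ck_sub _ (Cf k)) (Ck_sub _ (Cg k));
  by move=> _ [y [[Vy V'y] iy] <-]; exists y.
Qed.

Lemma smooth_at_add x f g :
  smooth_at x f -> smooth_at x g -> smooth_at x (fun y => f y + g y).
Proof. by apply: smooth_at2 => k U u v; exact: Ck_add. Qed.

Lemma smooth_at_mul x f g :
  smooth_at x f -> smooth_at x g -> smooth_at x (fun y => f y * g y).
Proof. by apply: smooth_at2 => k U u v; exact: Ck_mul. Qed.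

Lemma smooth_at_opp x f : smooth_at x f -> smooth_at x (fun y => - f y).
Proof.
move=> Sf; apply: smooth_at_near (smooth_at_mul (smooth_at_cst x (-1)) Sf).
by apply: nearW => y; rewrite /cst mulN1r.
Qed.

Lemma smooth_at_sub x f g :
  smooth_at x f -> smooth_at x g -> smooth_at x (fun y => f y - g y).
Proof. by move=> Sf Sg; apply: smooth_at_add Sf (smooth_at_opp Sg). Qed.

Lemma smooth_at_sum x (I : Type) (s : seq I) (P : pred I) (f : I -> M -> R) :
  (forall i, P i -> smooth_at x (f i)) ->
  smooth_at x (fun y => \sum_(i <- s | P i) f i y).
Proof.
move=> Sf; elim: s => [|i s IH].
  by apply: smooth_at_near (smooth_at_cst x 0); apply: nearW => y; rewrite big_nil.
case Pi : (P i); last by apply: smooth_at_near IH; apply: nearW => y; rewrite big_cons Pi.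
apply: smooth_at_near (smooth_at_add (Sf _ Pi) IH).
by apply: nearW => y; rewrite big_cons Pi.
Qed.

Lemma smooth_at_prod x (I : Type) (s : seq I) (P : pred I) (f : I -> M -> R) :
  (forall i, P i -> smooth_at x (f i)) ->
  smooth_at x (fun y => \prod_(i <- s | P i) f i y).
Proof.
move=> Sf; elim: s => [|i s IH].
  by apply: smooth_at_near (smooth_at_cst x 1); apply: nearW => y; rewrite big_nil.
case Pi : (P i); last by apply: smooth_at_near IH; apply: nearW => y; rewrite big_cons Pi.
apply: smooth_at_near (smooth_at_mul (Sf _ Pi) IH).
by apply: nearW => y; rewrite big_cons Pi.
Qed.

Lemma smooth_at_continuous x f : smooth_at x f -> {for x, continuous f}.
Proof.
move=> [i [V [oV Vx ix Cf]]].
have cf : {for cmap i x, continuous ((f : M -> R^o) \o cinv i)}.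
  by apply: (Cf 0%N); exists x.
have cc := cmap_continuous ix.
have := continuous_comp cc cf.
change (((f \o cinv i) \o cmap i) y @[y --> x] --> f (cinv i (cmap i x)) ->
   f @ x --> f x).
rewrite cmapK //; apply: cvg_trans.
apply: (near_eq_cvg (F := nbhs x)); near=> y; rewrite /= cmapK //.
by near: y; apply: open_nbhs_nbhs; split=> //; exact: cdom_open.
Unshelve. all: by end_near. Qed.

Lemma smooth_at_inv x f : smooth_at x f -> f x != 0 ->
  smooth_at x (fun y => (f y)^-1).
Proof.
move=> Sf fx0.
have nf0 : \near x, f x != 0.
  have := smooth_at_continuous Sf.
  move/(_ [set t | t != 0]); apply.
  by apply: open_nbhs_nbhs; split=> //; exact: open_neq.
have [W [oW Wx f0]] := nbhs_open nf0.
have [i [V [oV Vx ix Cf]]] := Sf.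
have oVW : open (V `&` W) by exact: openI.
exists i, (V `&` W); split=> // k.
apply: (Ck_inv (open_chart_image oVW) _ (Ck_sub _ (Cf k))).
  by move=> _ [y [[Vy Wy] iy] <-] /=; rewrite cmapK //; exact: f0.
by move=> _ [y [[Vy Wy] iy] <-]; exists y.
Qed.

Lemma smooth_at_det n x (A : M -> 'M[R]_n) :
  (forall i j, smooth_at x (fun y => A y i j)) ->
  smooth_at x (fun y => \det (A y)).
Proof.
move=> SA; apply: smooth_at_sum => s _; apply: smooth_at_mul.
  exact: smooth_at_cst.
by apply: smooth_at_prod => i _.
Qed.

Lemma smooth_at_adj n x (A : M -> 'M[R]_n) i j :
  (forall i j, smooth_at x (fun y => A y i j)) ->
  smooth_at x (fun y => (\adj (A y)) i j).
Proof.
move=> SA.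
have Sm : smooth_at x (fun y => \det (row' j (col' i (A y)))).
  apply: smooth_at_det => k l.
  by apply: smooth_at_near (SA (lift j k) (lift i l)); apply: nearW => y; rewrite !mxE.
apply: smooth_at_near (smooth_at_mul (smooth_at_cst x ((-1) ^+ (j + i))) Sm).
by apply: nearW => y; rewrite mxE.
Qed.

(** A Euclidean bump is read in a chart and extended by 0. The set [K] is compact, hence closed
    because [M] is Hausdorff, so the extension vanishes near every point outside the chart
    domain. *)
Lemma smooth_bump U x : open U -> U x ->
  exists chi : M -> R, exists K : set M,
    [/\ forall y, smooth_at y chi, closed K, K `<=` U, forall y, ~ K y -> chi y = 0
      & \near x, chi x = 1].
Proof.
move=> oU Ux; pose i := chart_at x.
have ix : cdom i x by exact: chart_atP.
have Ox : (cmap i @` (U `&` cdom i)) (cmap i x) by exists x.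
have [chi0 [K0 [C0 cK0 K0O chiK0 chi1]]] :=
  euclidean_bump (open_chart_image oU) Ox.
pose K := cinv i @` K0.
have KU : K `<=` U `&` cdom i.
  by move=> _ [a /K0O[y [Uy iy] <-] <-]; rewrite cmapK.
have clK : closed K.
  apply: compact_closed; first exact: mhausdorff.
  apply: continuous_compact cK0; apply: continuous_in_subspaceT => a.
  rewrite inE => /K0O[y [Uy iy] <-]; apply: cinv_continuous; by exists y.
pose chi y : R := if `[< cdom i y >] then chi0 (cmap i y) else 0.
have chiE y : cdom i y -> chi y = chi0 (cmap i y).
  by move=> iy; rewrite /chi asboolT.
have chiK y : ~ K y -> chi y = 0.
  rewrite /chi; case: asboolP => // iy Ky; apply: chiK0 => K0y; apply: Ky.
  by exists (cmap i y); rewrite ?cmapK.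
exists chi, K; split=> //.
- move=> y; have [iy|niy] := pselect (cdom i y).
    exists i, (cdom i); split=> //; first exact: cdom_open.
    move=> k; apply: (Ck_ext (open_chart_image (cdom_open i)) _ (Ck_sub _ (C0 k))) => //.
    by move=> _ [z [iz _] <-] /=; rewrite cmapK // chiE.
  apply: smooth_at_near (smooth_at_cst y 0).
  have oKC : open (~` K) by exact: closed_openC.
  near=> z; rewrite chiK //; near: z; apply: open_nbhs_nbhs; split=> //.
  by move=> /KU[].
- by move=> y /KU[].
- have c1 := cmap_continuous ix chi1.
  near=> y; rewrite chiE; first by near: y.
  by near: y; apply: open_nbhs_nbhs; split=> //; exact: cdom_open.
Unshelve. all: by end_near. Qed.

(** Extension by zero: [f] is controlled on [U] only, and off the closed set [K] the product
    vanishes in a neighbourhood. *)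
Lemma smooth_at_bump_mul U K (chi f : M -> R) : closed K -> K `<=` U ->
  (forall y, ~ K y -> chi y = 0) -> (forall y, smooth_at y chi) ->
  (forall y, U y -> smooth_at y f) -> forall y, smooth_at y (fun z => chi z * f z).
Proof.
move=> clK KU chi0 Schi Sf y; have [Ky|Ky] := pselect (K y).
  by apply: smooth_at_mul => //; exact/Sf/KU.
apply: smooth_at_near (smooth_at_cst y 0).
have oKC : open (~` K) by exact: closed_openC.
by near=> z; rewrite chi0 ?mul0r //; near: z; exact: open_nbhs_nbhs.
Unshelve. all: by end_near. Qed.

End OneManifold.

Lemma smooth_at_comp m n (M : manifold R m) (N : manifold R n) (h : M -> N) x
    (f : N -> R) :
  smooth_map h -> smooth_at (h x) f -> smooth_at x (f \o h).
Proof.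
move=> [ch Sh] [j [V [oV Vx jx Cf]]].
have oW : open (h @^-1` (V `&` cdom j)).
  apply: open_comp => //; apply: openI => //; exact: cdom_open.
exists (chart_at x), (h @^-1` (V `&` cdom j)); split=> //.
  exact: chart_atP.
set i := chart_at x.
apply: (Cinfty_comp_on (open_chart_image oW) _ _ Cf (G := cmap j \o h \o cinv i)).
  move=> _ [y [[Vy jy] iy] <-] /=; rewrite cmapK //; split; first by exists (h y).
  by rewrite cmapK.
move=> k; apply: Ck_sub (Sh i j k) => _ [y [[Vy jy] iy] <-].
by exists y.
Qed.

(** Each [x] lies in a basic open set contained in [W x]. For every number of a basic open set that
    is contained in some [W y], one such [y] is chosen; the other numbers receive [None]. *)
Lemma lindelof (T : topologicalType) (W : T -> set T) :
  @second_countable T -> (forall x, nbhs x (W x)) ->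
  exists u : nat -> option T, forall x : T, exists n (y : T),
    u n = Some y /\ nbhs x (W y).
Proof.
move=> [B /countable_injP[f finj] [Bopen Bbase]] nW.
pose P n y := exists b, [/\ B b, f b = n & b `<=` W y].
pose u n := if pselect (exists y, P n y) is left e then Some (sval (cid e)) else None.
exists u => x; have [b [Bb bx] bW] := Bbase x _ (nW x).
exists (f b); rewrite /u; case: pselect => [e|[]]; last by exists x, b.
exists (sval (cid e)); split=> //; move: (svalP (cid e)); set y := sval _.
move=> [b' [Bb' fb' b'W]]; have bb : b' = b by apply: finj; rewrite ?inE.
by rewrite nbhsE; exists b; [split=> //; exact: Bopen|move: b'W; rewrite bb].
Qed.

End ManifoldCalculus.

(** * Vector bundles and annihilators *)

Definition linear_pack (R : nzRingType) (U V : lmodType R) (f : U -> V)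
    (lf : linear f) : {linear U -> V} :=
  HB.pack f (GRing.isLinear.Build _ _ _ _ f lf).

Section BundleCalculus.
Context {R : realType} {m : nat} {M : manifold R m} {p : nat}.
Context {F : prebundle M p} (vbF : vector_bundle F).
Implicit Types (u v : sect F) (f g : M -> R) (w : lform F 1).

Lemma tdom_open (i : tidx F) : open (tdom i).
Proof. by case: vbF. Qed.

Lemma tdom_cover x : exists i : tidx F, tdom i x.
Proof. by case: vbF => _ /(_ x). Qed.

Lemma tmap_linear (i : tidx F) x : tdom i x -> linear (@tmap _ _ _ _ F i x).
Proof. by case: vbF => _ _ H _ /H[]. Qed.

Lemma tmapK (i : tidx F) x : tdom i x ->
  cancel (@tmap _ _ _ _ F i x) (@tinv _ _ _ _ F i x).
Proof. by case: vbF => _ _ H _ /H[]. Qed.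

Lemma tinvK (i : tidx F) x : tdom i x ->
  cancel (@tinv _ _ _ _ F i x) (@tmap _ _ _ _ F i x).
Proof. by case: vbF => _ _ H _ /H[]. Qed.

Lemma tmapZD (i : tidx F) x (a b : R) (u v : F x) : tdom i x ->
  tmap i x (a *: u + b *: v) = a *: tmap i x u + b *: tmap i x v.
Proof.
by move=> ix; rewrite -[LHS]/(linear_pack (tmap_linear ix) _) linearD !linearZ.
Qed.

Lemma tmap_sum (i : tidx F) x (I : finType) (a : I -> R) (u : I -> F x) : tdom i x ->
  tmap i x (\sum_j a j *: u j) = \sum_j a j *: tmap i x (u j).
Proof.
move=> ix; rewrite -[LHS]/(linear_pack (tmap_linear ix) _) linear_sum.
by apply: eq_bigr => j _; rewrite linearZ.
Qed.

Lemma smooth_sectP u : smooth_sect u <->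
  forall (i : tidx F) j x, tdom i x -> smooth_at x (fun y => tmap i y (u y) 0 j).
Proof.
have oi (i : tidx F) : open (setT `&` tdom i) by rewrite setTI; exact: tdom_open.
split=> [Su i|Su i]; first have /(smooth_on_rowP _ (oi i)) := Su i.
  by move=> H j x ix; apply: H.
by apply/(smooth_on_rowP _ (oi i)) => j x [_ ix]; exact: Su.
Qed.

Lemma smooth_sect_local u :
  (forall x : M, exists2 u', smooth_sect u' & \forall y \near x, u y = u' y) ->
  smooth_sect u.
Proof.
move=> H; apply/smooth_sectP => i j x ix.
have [u' /smooth_sectP/(_ i j x ix) Su' uu'] := H x.
by apply: smooth_at_near Su'; apply: filterS uu' => y ->.
Qed.

Lemma sect_ext u v : (forall x, u x = v x) -> u = v.
Proof. exact: functional_extensionality_dep. Qed.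

Lemma smooth_sect_ext u v : (forall x, u x = v x) -> smooth_sect u -> smooth_sect v.
Proof. by move=> /sect_ext ->. Qed.

Lemma smooth_sectZD f g u v : smooth_fun f -> smooth_fun g ->
  smooth_sect u -> smooth_sect v -> smooth_sect (fun x => f x *: u x + g x *: v x).
Proof.
move=> /smooth_funP Sf /smooth_funP Sg /smooth_sectP Su /smooth_sectP Sv.
apply/smooth_sectP => i j x ix.
have := smooth_at_add (smooth_at_mul (Sf x) (Su i j x ix))
  (smooth_at_mul (Sg x) (Sv i j x ix)).
apply: smooth_at_near; near=> y; rewrite tmapZD ?mxE //.
by near: y; apply: open_nbhs_nbhs; split=> //; exact: tdom_open.
Unshelve. all: by end_near. Qed.

Lemma smooth_fun_cst c : smooth_fun (cst c : M -> R).
Proof. by apply/smooth_funP => x; exact: smooth_at_cst. Qed.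

Lemma smooth_sectZ f u : smooth_fun f -> smooth_sect u ->
  smooth_sect (fun x => f x *: u x).
Proof.
move=> Sf Su; apply: smooth_sect_ext (smooth_sectZD Sf (smooth_fun_cst 0) Su Su).
by move=> x; rewrite scale0r addr0.
Qed.

Lemma smooth_sectD u v : smooth_sect u -> smooth_sect v ->
  smooth_sect (fun x => u x + v x).
Proof.
move=> Su Sv.
apply: smooth_sect_ext (smooth_sectZD (smooth_fun_cst 1) (smooth_fun_cst 1) Su Sv).
by move=> x; rewrite !scale1r.
Qed.

Lemma smooth_sect0 : smooth_sect (fun x => 0 : F x).
Proof.
apply/smooth_sectP => i j x ix; apply: smooth_at_near (smooth_at_cst x 0).
near=> y; rewrite -[X in tmap i y X](scale0r (0 : F y)) -[X in tmap i y X]addr0.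
rewrite -[X in _ + X](scale0r (0 : F y)) tmapZD ?scale0r ?addr0 ?mxE //.
by near: y; apply: open_nbhs_nbhs; split=> //; exact: tdom_open.
Unshelve. all: by end_near. Qed.

Lemma smooth_sect_sum (I : Type) (s : seq I) (f : I -> M -> R) (u : I -> sect F) :
  (forall i, smooth_fun (f i)) -> (forall i, smooth_sect (u i)) ->
  smooth_sect (fun x => \sum_(i <- s) f i x *: u i x).
Proof.
move=> Sf Su; elim: s => [|i s IH].
  by apply: smooth_sect_ext smooth_sect0 => x; rewrite big_nil.
apply: smooth_sect_ext (smooth_sectD (smooth_sectZ (Sf i) (Su i)) IH) => x.
by rewrite big_cons.
Qed.

Lemma smooth_sect_frame (i : tidx F) (K : set M) (chi : M -> R) (c : 'rV[R]_p) :
  smooth_fun chi -> closed K -> K `<=` tdom i -> (forall y, ~ K y -> chi y = 0) ->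
  smooth_sect (fun y => chi y *: tinv i y c).
Proof.
move=> /smooth_funP Schi clK Ki chi0; apply/smooth_sectP => j l x jx.
have [Kx|nKx] := pselect (K x); last first.
  apply: smooth_at_near (smooth_at_cst x 0); near=> y.
  rewrite chi0; last by near: y; apply: open_nbhs_nbhs; split=> //; exact: closed_openC.
  have jy : tdom j y by near: y; apply: open_nbhs_nbhs; split=> //; exact: tdom_open.
  have := tmapZD 0 0 0 0 jy; rewrite !scale0r addr0 => ->.
  by rewrite addr0 mxE.
have oij : open (tdom i `&` tdom j) by apply: openI; exact: tdom_open.
case: vbF => _ _ _ /(_ i j c)/(smooth_on_rowP _ oij)/(_ l x (conj (Ki x Kx) jx)) Sl.
apply: smooth_at_near (smooth_at_mul (Schi x) Sl); near=> y.
have jy : tdom j y by near: y; apply: open_nbhs_nbhs; split=> //; exact: tdom_open.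
have := tmapZD (chi y) 0 (tinv i y c) 0 jy; rewrite !scale0r !addr0 => ->.
by rewrite mxE.
Unshelve. all: by end_near. Qed.

Lemma form1_ext w u v x : (forall y, u y = v y) -> w (fun=> u) x = w (fun=> v) x.
Proof. by move=> /sect_ext ->. Qed.

Lemma form1_smooth w u : is_form w -> smooth_sect u -> smooth_fun (w (fun=> u)).
Proof. by move=> [Sw _ _] Su; exact: Sw. Qed.

Lemma form1_lin w f g u v x : is_form w -> smooth_fun f -> smooth_fun g ->
  smooth_sect u -> smooth_sect v ->
  w (fun=> (fun x => f x *: u x + g x *: v x)) x =
    f x * w (fun=> u) x + g x * w (fun=> v) x.
Proof.
move=> [_ Lw _] Sf Sg Su Sv.
have E (s : sect F) : [eta (fun=> u) with (0 : 'I_1) |-> s] = (fun=> s) :> ('I_1 -> sect F).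
  by apply/funext => i /=; rewrite (ord1 i) eqxx.
have := Lw (fun=> u) 0 f g u v (fun=> Su) Sf Sg Su Sv.
by rewrite !E => ->.
Qed.

Lemma form1D w u v x : is_form w -> smooth_sect u -> smooth_sect v ->
  w (fun=> (fun x => u x + v x)) x = w (fun=> u) x + w (fun=> v) x.
Proof.
move=> Fw Su Sv; have := form1_lin x Fw (smooth_fun_cst 1) (smooth_fun_cst 1) Su Sv.
by rewrite /cst !mul1r => <-; apply: form1_ext => y; rewrite !scale1r.
Qed.

Lemma form1Z w f u x : is_form w -> smooth_fun f -> smooth_sect u ->
  w (fun=> (fun x => f x *: u x)) x = f x * w (fun=> u) x.
Proof.
move=> Fw Sf Su; have := form1_lin x Fw Sf (smooth_fun_cst 0) Su Su.
rewrite /cst mul0r addr0 => <-; by apply: form1_ext => y; rewrite scale0r addr0.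
Qed.

Lemma form1_0 w x : is_form w -> w (fun=> (fun x => 0 : F x)) x = 0.
Proof.
move=> Fw; have := form1Z x Fw (smooth_fun_cst 0) smooth_sect0.
rewrite /cst mul0r => <-; by apply: form1_ext => y; rewrite scale0r.
Qed.

Lemma form1_sum w (I : Type) (s : seq I) (f : I -> M -> R) (u : I -> sect F) x :
  is_form w -> (forall i, smooth_fun (f i)) -> (forall i, smooth_sect (u i)) ->
  w (fun=> (fun x => \sum_(i <- s) f i x *: u i x)) x =
    \sum_(i <- s) f i x * w (fun=> u i) x.
Proof.
move=> Fw Sf Su; elim: s => [|i s IH].
  rewrite big_nil -[RHS](form1_0 x Fw); by apply: form1_ext => y; rewrite big_nil.
rewrite big_cons -IH -form1Z // -form1D //.
- by apply: form1_ext => y; rewrite big_cons.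
- exact: smooth_sectZ.
- exact: smooth_sect_sum.
Qed.

(** Multiplying by a bump function equal to 1 at [x] and supported where [u = v] makes the two
    sections equal everywhere, and the form is linear over functions. *)
Lemma form1_local w u v x : is_form w -> smooth_sect u -> smooth_sect v ->
  (\forall y \near x, u y = v y) -> w (fun=> u) x = w (fun=> v) x.
Proof.
move=> Fw Su Sv /nbhs_open[W [oW Wx uv]].
have [chi [K [Schi _ KW chi0 chi1]]] := smooth_bump oW Wx.
have /smooth_funP Sc := Schi.
rewrite -[LHS]mul1r -[RHS]mul1r -(nbhs_singleton chi1) -!form1Z //.
apply: form1_ext => y.
have [/KW/uv/= -> //|/chi0 ->] := pselect (K y).
by rewrite !scale0r.
Qed.

End BundleCalculus.

Section SubbundleGeometry.
Context {R : realType} {m : nat} {M : manifold R m} {p : nat}.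
Context {F : prebundle M p} (vbF : vector_bundle F).

(** The rows of [S] are the coordinates of a local frame of [E] in a trivialization, which turns
    membership in [E] into membership in a row space. *)
Lemma frame_coordinates r (E : forall x, set (F x)) (x0 : M) : subbundle r E ->
  exists (i : tidx F) (U : set M) (S : M -> 'M[R]_(r, p)),
    [/\ open U /\ U x0, U `<=` tdom i, row_free (S x0),
        forall a b x, U x -> smooth_at x (fun y => S y a b)
      & forall x v, U x -> E x v <-> (tmap i x v <= S x)%MS].
Proof.
move=> /(_ x0)[U [s [oU Ux0 Ss indep span]]].
have [i ix0] := tdom_cover vbF x0.
pose S y : 'M[R]_(r, p) := \matrix_(a, b) tmap i y (s a y) 0 b.
have oUi : open (U `&` tdom i) by apply: openI => //; exact: tdom_open.
have SE x (a : 'rV[R]_r) : tdom i x ->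
    tmap i x (\sum_(j < r) a 0 j *: s j x) = a *m S x.
  move=> ix; rewrite tmap_sum //; apply/rowP => b; rewrite summxE mxE.
  by apply: eq_bigr => j _; rewrite !mxE.
exists i, (U `&` tdom i), S; split=> //.
- apply: inj_row_free => a; rewrite -SE // => a0; apply: (indep x0 Ux0).
  have := tmapK vbF ix0 (\sum_(j < r) a 0 j *: s j x0); rewrite a0 => <-.
  by have := tmapK vbF ix0 0; have := SE x0 0 ix0;
    rewrite mul0mx big1 => [->//|j _]; rewrite mxE scale0r.
- move=> a b x Ux; have /(smooth_on_rowP _ oUi)/(_ b x Ux) := Ss a i.
  by apply: smooth_at_near; apply: nearW => y; rewrite mxE.
- move=> x v [Ux ix]; split=> [/(span x Ux)[a ->]|/submxP[a va]].
    by rewrite SE // submxMl.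
  apply/(span x Ux); exists a.
  by apply: (can_inj (tmapK vbF ix)); rewrite SE.
Qed.

End SubbundleGeometry.

Section AnnihilatorDual.
Context {R : realType} {m : nat} {M : manifold R m} {r k : nat}.
Context {F : prebundle M (r + k)} (vbF : vector_bundle F).
(* [w j] is, up to a cut-off and a constant, the [(r + j)]-th coordinate in the
   frame [Q] extending the frame of [E] by constant vectors, times [\det Q]:
   thanks to this factor it is polynomial in the coordinates of [Q]. *)
Lemma annihilator_dual (E : forall x, set (F x)) (x0 : M) : subbundle r E ->
  exists (w : 'I_k -> lform F 1) (Y : 'I_k -> sect F),
    [/\ forall j, annihilator E (w j), forall j, smooth_sect (Y j),
        forall i j, w j (fun=> Y i) x0 = (i == j)%:R
      & forall Z : sect F, (forall j, w j (fun=> Z) x0 = 0) -> E x0 (Z x0)].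
Proof.
move=> hE; have [i [U [S [[oU Ux0] Ui Sfree Ssm ES]]]] := frame_coordinates vbF x0 hE.
(* The last [k] rows of the invertible matrix [row_ebase (S x0)] complete the rows of [S x0] to a
   basis; they are kept constant in [y]. *)
pose C : 'M[R]_(k, r + k) := dsubmx (row_ebase (S x0)).
pose Q y : 'M[R]_(r + k) := col_mx (S y) C.
have Qunit : Q x0 \in unitmx.
  have -> : Q x0 = block_mx (col_ebase (S x0)) 0 0 1%:M *m row_ebase (S x0).
    rewrite /Q -[X in col_mx X _](mulmx_ebase (S x0)) (eqP Sfree).
    rewrite -[row_ebase (S x0) in RHS]vsubmxK mul_block_col mul0mx mul0mx add0r addr0 mul1mx.
    congr col_mx; rewrite -mulmxA -[row_ebase (S x0) in LHS]vsubmxK.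
    by rewrite pid_mx_row mul_row_col mul1mx mul0mx addr0.
  rewrite unitmx_mul row_ebase_unit andbT unitmxE det_ublock det1 mulr1.
  by rewrite -unitmxE col_ebase_unit.
pose D := \det (Q x0).
have D0 : D != 0 by rewrite -unitfE -unitmxE.
have Qsm a b x : U x -> smooth_at x (fun y => Q y a b).
  move=> Ux; case: (split_ordP a) => a' ->.
    by apply: smooth_at_near (Ssm a' b x Ux); apply: nearW => y; rewrite col_mxEu.
  apply: smooth_at_near (smooth_at_cst x (C a' b)).
  by apply: nearW => y; rewrite col_mxEd.
have [chi [K [Schi clK KU chi0 chi1]]] := smooth_bump oU Ux0.
have chix0 : chi x0 = 1 := nbhs_singleton chi1.
pose c (j : 'I_k) (Z : sect F) y :=
  (tmap i y (Z y) *m \adj (Q y)) 0 (rshift r j) * D^-1.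
pose w (j : 'I_k) : lform F 1 := fun z y => chi y * c j (z 0) y.
pose Y (j : 'I_k) : sect F := fun y => chi y *: tinv i y (row j C).
have Frm j : is_form (w j).
  split.
  - move=> z Sz; apply/smooth_funP; apply: (smooth_at_bump_mul clK KU chi0 Schi) => y Uy.
    apply: smooth_at_mul (smooth_at_cst _ _).
    have Sc b : smooth_at y (fun y => (tmap i y (z 0 y)) 0 b * (\adj (Q y)) b (rshift r j)).
      apply: smooth_at_mul; first exact: ((smooth_sectP vbF (z 0)).1 (Sz 0) i b y (Ui _ Uy)).
      by apply: smooth_at_adj => a b'; exact: Qsm.
    apply: smooth_at_near (smooth_at_sum (index_enum _) (P := xpredT) (fun b _ => Sc b)).
    by apply: nearW => y'; rewrite [in RHS]mxE.
  - move=> z a f g u v Sz Sf Sg Su Sv; apply/funext => y.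
    rewrite /w /= (ord1 a) eqxx.
    have [Ky|/chi0 ->] := pselect (K y); last by rewrite !mul0r !mulr0 addr0.
    rewrite /c (tmapZD vbF); last exact/Ui/KU.
    by rewrite mulmxDl -!scalemxAl mxE [X in X + _]mxE [X in _ + X]mxE; ring.
  - by move=> z a b _; rewrite (ord1 a) (ord1 b) eqxx.
exists w, Y; split.
- move=> j; split=> // T [ST ET]; apply/funext => y; rewrite /w.
  have [Ky|/chi0 ->] := pselect (K y); last by rewrite mul0r.
  have /(ES y _ (KU _ Ky))/submxP[a ta] := ET y.
  (* A vector of [E] has coordinates [(a, 0)] in the frame [Q], and [Q y *m \adj (Q y)] is scalar,
     so the last [k] entries vanish. *)
  have tQ : tmap i y (T y) = row_mx a 0 *m Q y.
    by rewrite /Q mul_row_col mul0mx addr0.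
  by rewrite /c tQ -mulmxA mul_mx_adj mul_mx_scalar mxE row_mxEr mxE mulr0 mul0r mulr0.
- move=> j; apply: (smooth_sect_frame vbF _ _ clK) => //; first exact/smooth_funP.
  by move=> y /KU/Ui.
- move=> a j; rewrite /w /c /Y chix0 mul1r scale1r (tinvK vbF); last exact: Ui.
  have -> : row a C = delta_mx 0 (rshift r a) *m Q x0.
    by rewrite -rowE; apply/rowP => b; rewrite [LHS]mxE [RHS]mxE col_mxEd.
  rewrite -mulmxA mul_mx_adj mul_mx_scalar !mxE eqxx /= eq_rshift eq_sym.
  by rewrite mulrAC mulfV // mul1r.
- move=> Z Z0; apply/(ES x0 _ Ux0).
  (* Conversely, if the last [k] entries of [d] vanish, then [d *m Q x0], which is [D] times the
     coordinates of [Z x0], is a combination of the rows of [S x0]. *)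
  pose d := tmap i x0 (Z x0) *m \adj (Q x0).
  have d0 : rsubmx d = 0.
    apply/rowP => j; rewrite [LHS]mxE [RHS]mxE; have := Z0 j; rewrite /w /c chix0 mul1r => /eqP.
    by rewrite mulf_eq0 invr_eq0 (negbTE D0) orbF => /eqP.
  have : d *m Q x0 = D *: tmap i x0 (Z x0).
    by rewrite -mulmxA mul_adj_mx mul_mx_scalar.
  rewrite -[d]hsubmxK d0 mul_row_col mul0mx addr0 => dS.
  rewrite -[tmap i x0 (Z x0)]scale1r -(mulVf D0) -scalerA -dS.
  by rewrite scalemx_sub // submxMl.
Qed.

End AnnihilatorDual.

(** * Sections dual to a base of the annihilator *)

Section DualFrame.
Context {R : realType} {m : nat} {M : manifold R m} {r k : nat}.
Context {F : prebundle M (r + k)} (vbF : vector_bundle F).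
Context {E : forall x, set (F x)} (hE : subbundle r E).
Context {Theta : 'I_k -> lform F 1} (hTheta : form_base (annihilator E) Theta).

Lemma base_form a : is_form (Theta a).
Proof. by case: hTheta => /(_ a)[]. Qed.

(** The forms that detect membership in [E] at a point belong to the annihilator, hence are
    combinations of the [Theta a]. *)
Lemma sub_sectP (Z : sect F) : smooth_sect Z ->
  (forall a, Theta a (fun=> Z) = fun=> 0) <-> sub_sect E Z.
Proof.
move=> SZ; split=> [Z0|EZ a]; last by case: hTheta => /(_ a)[_] /(_ Z EZ).
split=> // x; have [w [Y [Aw _ _]]] := annihilator_dual vbF x hE; apply=> j.
case: hTheta => _ /(_ _ (Aw j))[f _ wf] _.
rewrite (wf (fun=> Z)) // /form_comb big1 // => a _.
by rewrite Z0 mulr0.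
Qed.

Lemma local_dual_frame (x0 : M) :
  exists (g : M -> R) (z : 'I_k -> sect F),
    [/\ smooth_fun g, \forall y \near x0, g y = 1, forall b, smooth_sect (z b)
      & forall a b y, Theta a (fun=> z b) y = g y * (a == b)%:R].
Proof.
have [w [Y [Aw SY wY _]]] := annihilator_dual vbF x0 hE.
pose B y : 'M[R]_k := \matrix_(a, b) Theta a (fun=> Y b) y.
have SB a b y : smooth_at y (fun y => B y a b).
  apply: smooth_at_near ((smooth_funP _).1 (form1_smooth (base_form a) (SY b)) y).
  by apply: nearW => y'; rewrite mxE.
have SD y : smooth_at y (fun y => \det (B y)) by apply: smooth_at_det => a b.
have D0 : \det (B x0) != 0.
  case: hTheta => _ span _.
  have [f wf] : exists f : 'I_k -> 'I_k -> M -> R,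
      forall j, form_eq (w j) (form_comb (f j) Theta).
    have /choice[f ff] : forall j, exists f, form_eq (w j) (form_comb f Theta).
      by move=> j; have [f _ wf] := span _ (Aw j); exists f.
    by exists f.
  (* Writing [w j] in terms of the [Theta a] and evaluating on [Y b] gives a left inverse of [B x0]:
     this is the pointwise independence of the [Theta a]. *)
  have fB : (\matrix_(j, a) f j a x0) *m B x0 = 1%:M.
    apply/matrixP => j b; rewrite !mxE eq_sym -(wY b j) (wf j) // /form_comb.
    by apply: eq_bigr => a _; rewrite !mxE.
  have := congr1 (fun A => \det A) fB; rewrite det_mulmx det1 => /eqP h.
  by apply/eqP => B0; move: h; rewrite B0 mulr0 eq_sym oner_eq0.
pose U := [set y | \det (B y) != 0].
have oU : open U.
  rewrite openE => y Uy; have := smooth_at_continuous (SD y).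
  move/(_ [set t | t != 0]); apply.
  by apply: open_nbhs_nbhs; split=> //; exact: open_neq.
have [chi [K [Schi clK KU chi0 chi1]]] := smooth_bump oU (D0 : U x0).
(* The inverse matrix of [B], by Cramer's rule, cut off by [chi]; the cut-off reappears as the
   factor [g]. *)
pose h c b y := chi y * ((\det (B y))^-1 * (\adj (B y)) c b).
have Sh c b : smooth_fun (h c b).
  apply/smooth_funP; apply: (smooth_at_bump_mul clK KU chi0 Schi) => y Uy.
  by apply: smooth_at_mul; [exact: smooth_at_inv|exact: smooth_at_adj].
exists chi, (fun b y => \sum_c h c b y *: Y c y); split=> //.
- exact/smooth_funP.
- by move=> b; exact: smooth_sect_sum.
- move=> a b y; rewrite (form1_sum vbF) //; last exact: base_form.
  rewrite (eq_bigr (fun c => chi y * (\det (B y))^-1 * (B y a c * \adj (B y) c b))); last first.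
    by move=> c _; rewrite /h [B y a c]mxE; ring.
  rewrite -mulr_sumr.
  have -> : \sum_c B y a c * \adj (B y) c b = \det (B y) * (a == b)%:R.
    have := congr1 (fun A : 'M[R]_k => A a b) (mul_mx_adj (B y)).
    by rewrite [X in X = _]mxE [X in _ = X]mxE mulr_natr => ->.
  have [/KU Uy|/chi0 ->] := pselect (K y); last by rewrite !mul0r.
  by rewrite mulrA mulfVK.
Qed.

(* The local frames [z n], with [Theta a (z n b) = g n * (a == b)] and the sets
   where [g n = 1] covering [M], are glued into
   [\sum_n (\prod_(j < n) (1 - g j)) z n]: this sum is locally finite, since
   its terms of index greater than [n] vanish where [g n = 1]. *)
Lemma dual_frame : exists z : 'I_k -> sect F,
  (forall b, smooth_sect (z b)) /\
  forall a b, Theta a (fun=> z b) = fun=> (a == b)%:R.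
Proof.
have /choice[G HG] : forall x0 : M, exists gz : (M -> R) * ('I_k -> sect F),
    [/\ smooth_fun gz.1, \forall y \near x0, gz.1 y = 1,
        forall b, smooth_sect (gz.2 b)
      & forall a b y, Theta a (fun=> gz.2 b) y = gz.1 y * (a == b)%:R].
  by move=> x0; have [g [z H]] := local_dual_frame x0; exists (g, z).
pose W x := [set y | (G x).1 y = 1].
have nW x : nbhs x (W x) by case: (HG x).
have [u Hu] := lindelof (@msecond_countable _ _ M) nW.
pose g n : M -> R := if u n is Some x then (G x).1 else cst 0.
(* An index carrying no point contributes the zero section together with [g n = 0], so that [Tz]
   holds for every [n]. *)
pose z n (b : 'I_k) : sect F := if u n is Some x then (G x).2 b else fun=> 0.
have Sg n : smooth_fun (g n).
  by rewrite /g; case: (u n) => [x|]; [case: (HG x)|exact: smooth_fun_cst].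
have Sz n b : smooth_sect (z n b).
  by rewrite /z; case: (u n) => [x|]; [case: (HG x)|exact: smooth_sect0].
have Tz n a b y : Theta a (fun=> z n b) y = g n y * (a == b)%:R.
  rewrite /z /g; case: (u n) => [x|]; first by case: (HG x) => _ _ _; apply.
  by rewrite (form1_0 vbF) ?mul0r //; exact: base_form.
have /choice[n0 Hn0] : forall x : M, exists n, \forall y \near x, g n y = 1.
  move=> x; have [n [y [un Wy]]] := Hu x; exists n.
  by rewrite /g un; exact: Wy.
pose q n y : R := \prod_(j < n) (1 - g j y).
pose T N b : sect F := fun y => \sum_(n < N) q n y *: z n b y.
have qS n y : q n.+1 y = q n y * (1 - g n y) by rewrite /q big_ord_recr.
have q0 n N y : g n y = 1 -> (n < N)%N -> q N y = 0.
  elim: N => // N IH gn; rewrite ltnS leq_eqVlt qS => /predU1P[<-|/(IH gn) ->].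
    by rewrite gn subrr mulr0.
  by rewrite mul0r.
have TE n N b y : g n y = 1 -> (n < N)%N -> T N b y = T n.+1 b y.
  move=> gn; elim: N => // N IH; rewrite ltnS leq_eqVlt => /predU1P[<- //|nN].
  by rewrite /T big_ord_recr /= -/(T N b y) IH // (q0 n) // scale0r addr0.
have Sq n : smooth_fun (q n).
  apply/smooth_funP => y; apply: smooth_at_prod => j _.
  apply: smooth_at_sub; first exact: smooth_at_cst.
  exact: ((smooth_funP _).1 (Sg j)).

have ST N b : smooth_sect (T N b) by apply: smooth_sect_sum.
(* The truncation index varies with [y], but by [TE] all sufficiently large indices give the same
   value, so near [x] the fixed index [n0 x] serves. *)
pose Z b : sect F := fun y => T (n0 y).+1 b y.
have ZT b x : \forall y \near x, Z b y = T (n0 x).+1 b y.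
  apply: filterS (Hn0 x) => y gy; rewrite /Z.
  rewrite -(TE _ (maxn (n0 y) (n0 x)).+1 b y gy) ?ltnS ?leq_maxr //.
  by rewrite -(TE _ (maxn (n0 y) (n0 x)).+1 b y (nbhs_singleton (Hn0 y))) ?ltnS ?leq_maxl.
have SZ b : smooth_sect (Z b).
  by apply: (smooth_sect_local vbF) => x; exists (T (n0 x).+1 b).
exists Z; split=> // a b; apply/funext => x.
rewrite (form1_local (base_form a) (SZ b) (ST _ b) (ZT b x)).
rewrite (form1_sum vbF) //; last exact: base_form.
(* Since [q n * g n = q n - q n.+1], the sum telescopes to [1 - q N], and [q N] vanishes at [x]. *)
rewrite (eq_bigr (fun n : 'I_(n0 x).+1 => (q n x - q n.+1 x) * (a == b)%:R)); last first.
  by move=> n _; rewrite Tz qS; ring.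
rewrite -mulr_suml -(big_mkord xpredT (fun n => q n x - q n.+1 x)).
have -> N : \sum_(0 <= n < N) (q n x - q n.+1 x) = 1 - q N x.
  elim: N => [|N IH]; first by rewrite big_geq // /q big_ord0 subrr.
  by rewrite big_nat_recr //= IH; ring.
by rewrite (q0 (n0 x)) ?subr0 ?mul1r //; exact: nbhs_singleton (Hn0 x).
Qed.

End DualFrame.

(** * The pull-back Lie algebroid *)

Section TangentCalculus.
Context {R : realType}.

Lemma smooth_at_differentiable m (M : manifold R m) x (f : M -> R) :
  smooth_at x f ->
  differentiable ((f : M -> R^o) \o cinv (chart_at x)) (cmap (chart_at x) x).
Proof.
move=> Sf; have [V [_ Vx /(_ 1%N)[df _]]] := smooth_at_chart Sf (chart_atP x).
by apply: df; exists x => //; split=> //; exact: chart_atP.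
Qed.

(** The chain rule for local representatives. Their composite agrees with the representative of
    [f \o k] only near the point, which is enough for the differential. *)
Lemma tangent_map_chain m n (M : manifold R m) (N : manifold R n) (k : M -> N) x
    (v : tangent M x) (f : N -> R) :
  smooth_map k -> smooth_at (k x) f ->
  'd ((f : N -> R^o) \o cinv (chart_at (k x))) (cmap (chart_at (k x)) (k x))
    (tangent_map k v) =
  'd ((f \o k : M -> R^o) \o cinv (chart_at x)) (cmap (chart_at x) x) v.
Proof.
move=> [ck Sk] Sf; set c := chart_at (k x); set c' := chart_at x.
have c'x : cdom c' x by exact: chart_atP.
have ckx : cdom c (k x) by exact: chart_atP.
have dk : differentiable (cmap c \o k \o cinv c') (cmap c' x).
  by have [+ _] := Sk c' c 1%N; apply; exists x.
have kx : (cmap c \o k \o cinv c') (cmap c' x) = cmap c (k x) by rewrite /= cmapK.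
have df := smooth_at_differentiable Sf.
have df' : differentiable ((f : N -> R^o) \o cinv c) ((cmap c \o k \o cinv c') (cmap c' x)).
  by rewrite kx.
have dc := differentiable_comp dk df'.
have eq_near : \forall a \near cmap c' x,
    (((f : N -> R^o) \o cinv c) \o (cmap c \o k \o cinv c')) a =
    ((f \o k : M -> R^o) \o cinv c') a.
  have oW : open (k @^-1` cdom c) by apply: open_comp => //; exact: cdom_open.
  apply: (open_near_eq (open_chart_image (i := c') oW)); first by exists x.
  by move=> _ [y [cky c'y] <-]; rewrite /= cmapK // cmapK.
have [_ ->] := near_eq_differentiable eq_near dc.
by move: kx; rewrite (diff_comp dk df') /= => ->.
Qed.

Section VectorFieldAction.
Context {m : nat} {M : manifold R m}.
Implicit Types (X : sect (tangent M)) (f g : M -> R).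

Lemma vf_actM X f g x : smooth_fun f -> smooth_fun g ->
  vf_act X (fun y => f y * g y) x = f x * vf_act X g x + g x * vf_act X f x.
Proof.
move=> /smooth_funP/(_ x)/smooth_at_differentiable df.
move=> /smooth_funP/(_ x)/smooth_at_differentiable dg.
have /(congr1 (fun L => L (X x))) := diffM df dg.
by rewrite /= cmapK; [|exact: chart_atP].
Qed.

Lemma vf_actD X f g x : smooth_fun f -> smooth_fun g ->
  vf_act X (fun y => f y + g y) x = vf_act X f x + vf_act X g x.
Proof.
move=> /smooth_funP/(_ x)/smooth_at_differentiable df.
move=> /smooth_funP/(_ x)/smooth_at_differentiable dg.
by have /(congr1 (fun L => L (X x))) := diffD df dg.
Qed.

Lemma vf_act_cst X (c : R) x : vf_act X (fun=> c) x = 0.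
Proof.
have := @diff_cst R 'rV[R]_m R^o c (cmap (chart_at x) x).
by move/(congr1 (fun L => L (X x))).
Qed.

End VectorFieldAction.
End TangentCalculus.

(** [Gamma] moves values between fibres along an equality of base points; this fact and the next
    three let linear operations, trivializations and differentials pass through the transport. *)
Lemma eq_rectZD (R : nzRingType) (T : Type) (V : T -> lmodType R) x y (e : x = y)
    (a : R) (u v : V x) :
  eq_rect x V (a *: u + v) y e = a *: eq_rect x V u y e + eq_rect x V v y e.
Proof. by case: _ / e. Qed.

Lemma tmap_eq_rect (R : realType) m (M : manifold R m) p (F : prebundle M p)
    (i : tidx F) x y (e : x = y) (v : F x) :
  tmap i y (eq_rect x (fib F) v y e) = tmap i x v.
Proof. by case: _ / e. Qed.

Lemma vf_act_eq_rect (R : realType) m (M : manifold R m) (f : M -> R) x y (e : x = y)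
    (v : tangent M x) :
  'd ((f : M -> R^o) \o cinv (chart_at y)) (cmap (chart_at y) y)
    (eq_rect x (fib (tangent M)) v y e) =
  'd ((f : M -> R^o) \o cinv (chart_at x)) (cmap (chart_at x) x) v.
Proof. by case: _ / e. Qed.

Lemma eq_rect0 (R : nzRingType) (T : Type) (V : T -> lmodType R) x y (e : x = y) :
  eq_rect x V 0 y e = 0.
Proof. by case: _ / e. Qed.

Section PullbackBundle.
Context {R : realType} {m n p : nat} {M : manifold R m} {N : manifold R n}.
Context (A : gen_lie_algebroid M N p).
Let h := gh A.
Implicit Types (Z W : sect (hF A)) (f g a : M -> R).

Lemma smooth_gh : smooth_map h. Proof. by case: (gh_diffeo A). Qed.
Lemma smooth_ghV : smooth_map (binv h). Proof. by case: (gh_diffeo A). Qed.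

Lemma smooth_fun_ghV f : smooth_fun f -> smooth_fun (f \o binv h).
Proof.
move=> /smooth_funP Sf; apply/smooth_funP => y.
by apply: smooth_at_comp; [exact: smooth_ghV|exact: Sf].
Qed.

Lemma vector_bundle_hF : vector_bundle (hF A).
Proof.
have [oF cF lF sF] := gF_vb A; have [ch _] := smooth_gh.
split=> [i|x|i x|i j a].
- by apply: open_comp => //; exact: oF.
- exact: cF.
- exact: lF.
- have oij : open (tdom (F := gF A) i `&` tdom (F := gF A) j) by apply: openI; exact: oF.
  have oij' : open ((tdom (F := hF A) i) `&` (tdom (F := hF A) j)).
    exact: (open_comp (f := h) (fun x _ => ch x) oij).
  apply/(smooth_on_rowP _ oij') => b x [ix jx].
  have /(smooth_on_rowP _ oij)/(_ b (h x) (conj ix jx)) := sF i j a.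
  exact: (smooth_at_comp smooth_gh).
Qed.

Lemma hdescE Z x : hdesc Z (h x) = Z x.
Proof.
rewrite /hdesc /Gamma; move: (binvK _ _); rewrite -/h.
(* Once [binv h (h x)] is replaced by [x], the transport is along a proof of an equality of [h x]
   with itself, which is reflexivity by proof irrelevance. *)
by move: (bfunK h x) => e; case: _ / (esym e) => E; rewrite (Prop_irrelevance E erefl).
Qed.

Lemma hdescZD a Z W y : hdesc (fun x => a x *: Z x + W x) y =
  a (binv h y) *: hdesc Z y + hdesc W y.
Proof. exact: eq_rectZD. Qed.

Lemma smooth_hdesc Z : smooth_sect Z -> smooth_sect (hdesc Z).
Proof.
move=> SZ; apply/(smooth_sectP (gF_vb A)) => i j y iy.
have ix : tdom (F := hF A) i (binv h y) by rewrite /= -/h binvK.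
have := (smooth_sectP vector_bundle_hF Z).1 SZ i j (binv h y) ix.
move/(smooth_at_comp smooth_ghV); apply: smooth_at_near; apply: nearW => z /=.
by rewrite /hdesc /Gamma tmap_eq_rect.
Qed.

Lemma smooth_pull (z : sect (gF A)) : smooth_sect z ->
  smooth_sect (F := hF A) (fun x => z (h x)).
Proof.
move=> Sz; apply/(smooth_sectP vector_bundle_hF) => i j x ix.
have := (smooth_sectP (gF_vb A) z).1 Sz i j (h x) ix.
exact: (smooth_at_comp smooth_gh).
Qed.

Lemma hbr_smooth Z W : smooth_sect Z -> smooth_sect W -> smooth_sect (hbr Z W).
Proof.
by move=> SZ SW; apply: smooth_pull; apply: gbr_smooth; exact: smooth_hdesc.
Qed.

Lemma hdescD Z W : hdesc (fun x => Z x + W x) = fun y => 1 *: hdesc Z y + hdesc W y.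
Proof.
apply: sect_ext => y; rewrite -(hdescZD (fun=> 1)).
by congr (hdesc _ y); apply: sect_ext => x; rewrite scale1r.
Qed.

Lemma hbrDl Z W V x : smooth_sect Z -> smooth_sect W -> smooth_sect V ->
  hbr (fun x => Z x + W x) V x = hbr Z V x + hbr W V x.
Proof.
move=> SZ SW SV; rewrite /hbr hdescD gbr_linearl ?scale1r //; exact: smooth_hdesc.
Qed.

Lemma hbrDr Z W V x : smooth_sect Z -> smooth_sect W -> smooth_sect V ->
  hbr V (fun x => Z x + W x) x = hbr V Z x + hbr V W x.
Proof.
move=> SZ SW SV; rewrite /hbr hdescD gbr_linearr ?scale1r //; exact: smooth_hdesc.
Qed.

Lemma hbrxx Z x : smooth_sect Z -> hbr Z Z x = 0.
Proof. by move=> SZ; rewrite /hbr gbr_alternating //; exact: smooth_hdesc. Qed.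

Lemma hbrC Z W x : smooth_sect Z -> smooth_sect W -> hbr Z W x = - hbr W Z x.
Proof.
move=> SZ SW; have SD := smooth_sectD vector_bundle_hF SZ SW.
have := hbrxx x SD; rewrite hbrDl // !hbrDr // !hbrxx // add0r addr0.
by move/eqP; rewrite addr_eq0 => /eqP.
Qed.

(** The chain rule for the inverse of [h]: the anchor of [Z] is [h]-related to
    [gtheta (hdesc Z)]. *)
Lemma vf_act_hanchor Z f x : smooth_fun f ->
  vf_act (hanchor Z) f x = vf_act (gtheta (hdesc Z)) (f \o binv h) (h x).
Proof.
move=> /smooth_funP Sf; rewrite [RHS]/vf_act.
rewrite -(tangent_map_chain _ smooth_ghV (Sf _)).
exact: vf_act_eq_rect.
Qed.

Lemma hbr_leibniz f Z W x : smooth_fun f -> smooth_sect Z -> smooth_sect W ->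
  hbr Z (fun x => f x *: W x) x = f x *: hbr Z W x + vf_act (hanchor Z) f x *: W x.
Proof.
move=> Sf SZ SW; rewrite vf_act_hanchor // /hbr -/h.
have -> : hdesc (fun x => f x *: W x) = fun y => (f \o binv h) y *: hdesc W y.
  apply: sect_ext => y; have := hdescZD f W (fun=> 0) y.
  have -> : hdesc (fun x => 0 : hF A x) y = 0 by exact: eq_rect0.
  rewrite addr0 => <-; congr (hdesc _ y); apply: sect_ext => x'.
  by rewrite addr0.
rewrite gbr_leibniz //; [|exact: smooth_fun_ghV|exact: smooth_hdesc|exact: smooth_hdesc].
by rewrite /= bfunK hdescE.
Qed.

(* The anchor of [Z] at [x] depends on [Z] through its value at [anchor_base x];
   this point differs from [x] only where the anchor vanishes. *)
Definition anchor_base (x : M) : M :=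
  binv h (binv (bijection_comp (geta A) h) (h x)).

(** Each use of [Gamma] is linear on fibres but reads its section at a preimage of the base point;
    the three preimages compose to [anchor_base x]. *)
Lemma hanchorZD a Z W x : hanchor (fun x => a x *: Z x + W x) x =
  a (anchor_base x) *: hanchor Z x + hanchor W x.
Proof.
have [_ rho_lin _] := grho_morphism A.
have thetaZD (u v : sect (gF A)) (b : N -> R) y :
    gtheta (fun y => b y *: u y + v y) y =
    b (binv (bijection_comp (geta A) h) y) *: gtheta u y + gtheta v y.
  rewrite /gtheta /Gamma rho_lin /tangent_map linearP.
  exact: (eq_rectZD (V := fib (tangent N))).
have hE : hdesc (fun x => a x *: Z x + W x) =
    fun y => (a \o binv h) y *: hdesc Z y + hdesc W y.
  by apply: sect_ext => y; exact: hdescZD.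
rewrite /hanchor hE /Gamma thetaZD /tangent_map linearP.
exact: (eq_rectZD (V := fib (tangent M))).
Qed.

Lemma vf_act_hanchorZD a Z W f x :
  vf_act (hanchor (fun x => a x *: Z x + W x)) f x =
  a (anchor_base x) * vf_act (hanchor Z) f x + vf_act (hanchor W) f x.
Proof. by rewrite /vf_act hanchorZD linearP. Qed.

End PullbackBundle.

(** * Linearity of the anchor over functions *)

Section AnchorLinearity.
Context {R : realType} {m n p : nat} {M : manifold R m} {N : manifold R n}.
Context (A : gen_lie_algebroid M N p).
Implicit Types (Z W U V : sect (hF A)) (f g : M -> R) (x : M).
Let vb := vector_bundle_hF A.

(** A frame vector extended to a global section. The index [l], here and below, also records that
    the rank is positive. *)
Lemma bump_frame (l : 'I_p) x : exists (i : tidx (hF A)) (chi : M -> R),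
  [/\ tdom i x, smooth_fun chi, \forall y \near x, chi y = 1
    & smooth_sect (fun y => chi y *: @tinv _ _ _ _ (hF A) i y (delta_mx 0 l))].
Proof.
have [i ix] := tdom_cover vb x.
have [chi [K [/smooth_funP Schi clK KU chi0 chi1]]] := smooth_bump (tdom_open vb i) ix.
by exists i, chi; split=> //; exact: (smooth_sect_frame vb _ Schi clK KU chi0).
Qed.

(* By the Leibniz rule the anchor can be read off the bracket with a local
   frame, so its smoothness follows from that of the bracket. *)
Lemma vf_act_hanchor_smooth (l : 'I_p) Z f : smooth_sect Z -> smooth_fun f ->
  smooth_fun (vf_act (hanchor Z) f).
Proof.
move=> SZ Sf; apply/smooth_funP => x.
have [i [chi [ix Schi chi1 Se]]] := bump_frame l x.
set e := (fun y => chi y *: _) in Se.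
have Sfe : smooth_sect (fun y => f y *: e y) by exact: smooth_sectZ.
have SNf : smooth_fun (fun y => - f y).
  by apply/smooth_funP => y; apply: smooth_at_opp; exact: ((smooth_funP _).1 Sf).
(* The section [[Z, f e] - f [Z, e]] is [Z(f) e], whose [l]-th coordinate near [x] is [Z(f)]. *)
have Sbr := smooth_sectZD vb (smooth_fun_cst 1) SNf
  (hbr_smooth SZ Sfe) (hbr_smooth SZ Se).
apply: smooth_at_near ((smooth_sectP vb _).1 Sbr i l x ix); near=> y.
have iy : tdom i y.
  by near: y; apply: open_nbhs_nbhs; split=> //; exact: tdom_open.
rewrite hbr_leibniz // /cst scale1r scaleNr addrAC subrr add0r.
rewrite /e (near chi1 y) // scale1r.
have := tmapZD vb (vf_act (hanchor Z) f y) 0 (@tinv _ _ _ _ (hF A) i y (delta_mx 0 l)) 0 iy.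
rewrite !scale0r !addr0 => ->.
by rewrite (tinvK vb iy) !mxE !eqxx mulr1.
Unshelve. all: by end_near. Qed.

Lemma vf_act_hanchorZ f Z g x :
  vf_act (hanchor (fun x => f x *: Z x)) g x =
  f (anchor_base A x) * vf_act (hanchor Z) g x.
Proof.
pose O : sect (hF A) := fun=> 0.
have O0 : vf_act (hanchor O) g x = 0.
  have := vf_act_hanchorZD (fun=> 1) O O g x.
  have -> : (fun x => 1 *: O x + O x) = O.
    by apply: sect_ext => y; rewrite /O scaler0 addr0.
  by rewrite mul1r => /eqP; rewrite -subr_eq0 opprD addNKr oppr_eq0 => /eqP.
have := vf_act_hanchorZD f Z O g x; rewrite O0 addr0 => <-.
by congr (vf_act (hanchor _) g x); apply: sect_ext => y; rewrite addr0.
Qed.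

(* Expand [hbr (g Z) (g Z) = 0] by the Leibniz rule on both sides. *)
Lemma anchor_self_bracket Z g x : smooth_sect Z -> smooth_fun g ->
  ((g (anchor_base A x) - g x) * vf_act (hanchor Z) g x) *: Z x = 0.
Proof.
move=> SZ Sg; have SgZ : smooth_sect (fun y => g y *: Z y) by exact: smooth_sectZ.
have := hbrxx x SgZ; rewrite [X in X = _]hbr_leibniz // hbrC // hbr_leibniz // hbrxx //.
rewrite scaler0 add0r vf_act_hanchorZ scalerN scalerA -scaleNr -scalerDl => <-.
by congr (_ *: _); ring.
Qed.

(** For a section not vanishing at [x], [anchor_self_bracket] kills [(g t - g x) * Z(g)(x)] for
    every [g]. A bump [b] separating [x] from [t] gives [Z(b)(x) = 0]; adding a multiple of [b] to
    [f] then adjusts the difference of values without changing the derivative at [x]. *)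
Lemma vf_act_hanchor_eq0 (l : 'I_p) Z f x : smooth_sect Z -> smooth_fun f ->
  anchor_base A x <> x -> vf_act (hanchor Z) f x = 0.
Proof.
move=> SZ Sf nx; set t := anchor_base A x in nx *.
have oU : open (~` [set t]).
  apply: closed_openC; apply: accessible_closed_set1.
  by apply: hausdorff_accessible; exact: mhausdorff.
have Ux : (~` [set t]) x by move=> /= xt; apply: nx.
have [b [K [/smooth_funP Sb _ KU b0 b1]]] := smooth_bump oU Ux.
have bx : b x = 1 := nbhs_singleton b1.
have bt : b t = 0 by apply: b0 => /KU; apply.
have [i [chi [ix Schi chi1 Se]]] := bump_frame l x.
set e := (fun y => chi y *: _) in Se.
have ex0 : e x != 0.
  rewrite /e (nbhs_singleton chi1) scale1r; apply/eqP => e0.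
  have := tinvK vb ix (delta_mx 0 l).
  have := tmapZD vb 0 0 0 0 ix; rewrite !scale0r addr0 -e0 => -> /rowP/(_ l).
  by rewrite addr0 !mxE !eqxx => /eqP; rewrite eq_sym oner_eq0.
(* If [Z x = 0], then [V] replaces [Z]: it is nonzero at [x] and has the same anchor there, because
   [b t = 0]. *)
pose V : sect (hF A) := fun y => b y *: e y + Z y.
have SV : smooth_sect V.
  by apply: smooth_sectD => //; exact: smooth_sectZ.
have DV g : vf_act (hanchor V) g x = vf_act (hanchor Z) g x.
  by rewrite vf_act_hanchorZD -/t bt mul0r add0r.
have [Z' [SZ' Z'x DZ']] : exists Z', [/\ smooth_sect Z', Z' x != 0
    & forall g, vf_act (hanchor Z') g x = vf_act (hanchor Z) g x].
  have [Zx|Zx] := eqVneq (Z x) 0; last by exists Z.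
  by exists V; split=> //; rewrite /V bx scale1r Zx addr0.
have D0 g : smooth_fun g -> (g t - g x) * vf_act (hanchor Z) g x = 0.
  move=> Sg; have /eqP := anchor_self_bracket x SZ' Sg.
  by rewrite scaler_eq0 (negbTE Z'x) orbF DZ' => /eqP.
have Db : vf_act (hanchor Z) b x = 0.
  by have /eqP := D0 b Sb; rewrite bt bx sub0r mulN1r oppr_eq0 => /eqP.
(* Chosen so that [g = f + c * b] satisfies [g t - g x = 1]. *)
pose c := f t - f x - 1.
have Scb : smooth_fun (fun y => cst c y * b y).
  apply/smooth_funP => y; apply: smooth_at_mul; first exact: smooth_at_cst.
  exact: ((smooth_funP _).1 Sb).
have Sg : smooth_fun (fun y => f y + cst c y * b y).
  apply/smooth_funP => y; apply: smooth_at_add; first exact: ((smooth_funP _).1 Sf).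
  exact: ((smooth_funP _).1 Scb).
have := D0 _ Sg; rewrite (vf_actD _ _ Sf Scb) (vf_actM _ _ (smooth_fun_cst c) Sb).
rewrite Db vf_act_cst bt bx !mulr0 mulr1 !addr0 /cst /c.
by rewrite (_ : f t - (f x + _) = 1) ?mul1r //; ring.
Qed.

Lemma vf_act_hanchor_lin (l : 'I_p) f Z W g x :
  smooth_sect Z -> smooth_fun g ->
  vf_act (hanchor (fun x => f x *: Z x + W x)) g x =
  f x * vf_act (hanchor Z) g x + vf_act (hanchor W) g x.
Proof.
move=> SZ Sg; rewrite vf_act_hanchorZD.
have [->//|nx] := pselect (anchor_base A x = x).
by rewrite (vf_act_hanchor_eq0 l SZ Sg nx) !mulr0.
Qed.

End AnchorLinearity.

(** * The exterior derivative of 1-forms *)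

Section ExteriorDerivative.
Context {R : realType} {m n p : nat} {M : manifold R m} {N : manifold R n}.
Context (A : gen_lie_algebroid M N p).
Implicit Types (Z W U V : sect (hF A)) (f g : M -> R) (x : M) (w : lform (hF A) 1).
Let vb := vector_bundle_hF A.

(** The exterior derivative of a 1-form with its two arguments separated, to be handled as an
    alternating bilinear map. *)
Definition d1 w Z W : M -> R := fun x =>
  vf_act (hanchor Z) (w (fun=> W)) x - vf_act (hanchor W) (w (fun=> Z)) x
  - w (fun=> hbr Z W) x.

Lemma ext_d1E w z x : ext_d w z x = d1 w (z ord0) (z ord_max) x.
Proof.
rewrite /ext_d /d1 !big_ord_recl !big_ord0 /= !big_mkcond /= !big_ord_recl !big_ord0 /=.
have l0 : (fun k : 'I_1 => z (lift ord0 k)) = fun=> z ord_max.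
  by apply/funext => k; congr z; apply/val_inj; rewrite /= (ord1 k).
have -> : lift ord0 ord0 = ord_max :> 'I_2 by exact/val_inj.
rewrite l0; have -> : (fun k : 'I_1 => z (lift ord_max k)) = fun=> z ord0.
  by apply/funext => k; congr z; apply/val_inj; rewrite /= (ord1 k).
have -> : (fun k : 'I_1 => if (k == 0 :> nat)%N then hbr (z ord0) (z ord_max)
    else z (inord (bump 1 (bump 0 k.-1)))) = fun=> hbr (z ord0) (z ord_max).
  by apply/funext => k; rewrite (ord1 k).
rewrite big_pred0; last by case=> -[|[|j]].
by ring.
Qed.

Lemma wedge11E (w t : lform (hF A) 1) z x :
  wedge_form w t z x = w (fun=> z ord0) x * t (fun=> z ord_max) x
                       - w (fun=> z ord_max) x * t (fun=> z ord0) x.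
Proof.
(* The sum over the permutations of two indices is the Leibniz expansion of a determinant with rows
   [w] and [t]. *)
pose B : 'M[R]_2 := \matrix_(i, j)
  (if i == ord0 then w (fun=> z j) x else t (fun=> z j) x).
rewrite /wedge_form (_ : 1`! = 1%N) // mulr1 invr1 mul1r.
transitivity (\det B); last first.
  rewrite (expand_det_row _ ord0) !big_ord_recl big_ord0 /cofactor !det_mx11 !mxE /=.
  have -> : lift ord0 (0 : 'I_1) = ord_max :> 'I_2 by exact/val_inj.
  have -> : lift ord_max (0 : 'I_1) = ord0 :> 'I_2 by exact/val_inj.
  by rewrite /bump /=; ring.
apply: eq_bigr => s _; rewrite !big_ord_recl big_ord0 mulr1 !mxE /=.
have -> : (fun i : 'I_1 => z (s (lshift 1 i))) = fun=> z (s ord0).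
  by apply/funext => i; congr (z (s _)); apply/val_inj; rewrite /= (ord1 i).
have -> // : (fun i : 'I_1 => z (s (rshift 1 i))) = fun=> z (s (lift ord0 ord0)).
by apply/funext => i; congr (z (s _)); apply/val_inj; rewrite /= (ord1 i).
Qed.

Lemma d1C w Z W x : is_form w -> smooth_sect Z -> smooth_sect W ->
  d1 w Z W x = - d1 w W Z x.
Proof.
move=> Fw SZ SW; rewrite /d1.
have -> : w (fun=> hbr Z W) x = - w (fun=> hbr W Z) x.
  rewrite -mulN1r -(form1Z x Fw (smooth_fun_cst (-1)) (hbr_smooth SW SZ)).
  by apply: form1_ext => y; rewrite hbrC // scaleN1r.
ring.
Qed.

Lemma d1_smooth (l : 'I_p) w Z W : is_form w -> smooth_sect Z -> smooth_sect W ->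
  smooth_fun (d1 w Z W).
Proof.
move=> Fw SZ SW; apply/smooth_funP => x.
apply: smooth_at_sub; last exact: ((smooth_funP _).1 (form1_smooth Fw (hbr_smooth SZ SW))).
by apply: smooth_at_sub; apply: (smooth_funP _).1;
  apply: (vf_act_hanchor_smooth l) => //; exact: form1_smooth.
Qed.

(** The term [W(f) w(U)] from the Leibniz rule of the bracket cancels the one from differentiating
    [f * w(U)] along [W]; the remaining anchor term uses the linearity of the anchor over
    functions. *)
Lemma d1_lin (l : 'I_p) w f U V W x : is_form w -> smooth_fun f ->
  smooth_sect U -> smooth_sect V -> smooth_sect W ->
  d1 w (fun x => f x *: U x + V x) W x = f x * d1 w U W x + d1 w V W x.
Proof.
move=> Fw Sf SU SV SW; have SfU : smooth_sect (fun y => f y *: U y) by exact: smooth_sectZ.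
have SwU := form1_smooth Fw SU; have SwV := form1_smooth Fw SV.
have SwW := form1_smooth Fw SW.
have SfwU : smooth_fun (fun y => f y * w (fun=> U) y).
  apply/smooth_funP => y; apply: smooth_at_mul; exact: (smooth_funP _).1.
have SDf := vf_act_hanchor_smooth l SW Sf.
have SNDf : smooth_fun (fun y => - vf_act (hanchor W) f y).
  by apply/smooth_funP => y; apply: smooth_at_opp; exact: ((smooth_funP _).1 SDf).
have wlin : w (fun=> (fun y => f y *: U y + V y)) = fun y => f y * w (fun=> U) y + w (fun=> V) y.
  by apply/funext => y; rewrite form1D // form1Z.
have wbr : w (fun=> hbr (fun y => f y *: U y + V y) W) x =
    f x * w (fun=> hbr U W) x - vf_act (hanchor W) f x * w (fun=> U) x + w (fun=> hbr V W) x.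
  have SUW := hbr_smooth SU SW; have SVW := hbr_smooth SV SW.
  rewrite -mulNr -(form1_lin x Fw Sf SNDf SUW SU) -form1D //; last first.
    exact: smooth_sectZD.
  apply: form1_ext => y; rewrite hbrDl // (hbrC _ SfU) // hbr_leibniz //.
  by rewrite opprD -scalerN -hbrC // scaleNr.
rewrite /d1 (vf_act_hanchor_lin l _ _ _ SU SwW) wlin (vf_actD _ x SfwU SwV).
rewrite (vf_actM _ x Sf SwU) wbr.
move: (w (fun=> hbr U W) x) (w (fun=> hbr V W) x) (w (fun=> U) x) => w1 w2 w3.
move: (vf_act (hanchor U) _ x) (vf_act (hanchor V) _ x) => u v.
move: (vf_act (hanchor W) f x) (vf_act (hanchor W) _ x) (vf_act (hanchor W) _ x).
by move=> df a b; ring.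
Qed.

Lemma d1_sum (l : 'I_p) w (I : Type) (s : seq I) (f : I -> M -> R)
    (U : I -> sect (hF A)) W x : is_form w -> (forall i, smooth_fun (f i)) ->
  (forall i, smooth_sect (U i)) -> smooth_sect W ->
  d1 w (fun y => \sum_(i <- s) f i y *: U i y) W x = \sum_(i <- s) f i x * d1 w (U i) W x.
Proof.
move=> Fw Sf SU SW; pose O : sect (hF A) := fun=> 0.
have SO : smooth_sect O by exact: smooth_sect0.
elim: s => [|i s IH].
  have := d1_lin l x Fw (smooth_fun_cst (-1)) SO SO SW; rewrite mulN1r addNr big_nil => <-.
  congr (d1 w _ W x); apply: sect_ext => y; rewrite big_nil /O.
  by rewrite scaler0 addr0.
rewrite big_cons -IH -(d1_lin l) //; last exact: smooth_sect_sum.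
by congr (d1 w _ W x); apply: sect_ext => y; rewrite big_cons.
Qed.

End ExteriorDerivative.

(** * Structure equations *)

Section StructureEquations.
Context {R : realType} {m n r k : nat} {M : manifold R m} {N : manifold R n}.
Context {A : gen_lie_algebroid M N (r + k)}.
Context {E : forall x, set (hF A x)} (hE : subbundle r E).
Context {Theta : 'I_k -> lform (hF A) 1}.
Context (hTheta : form_base (annihilator E) Theta).
Implicit Types (Z W U V : sect (hF A)) (x : M).
Let vb := vector_bundle_hF A.
Let th a Z : M -> R := Theta a (fun=> Z).
Let FTh a : is_form (Theta a) := base_form hTheta a.

Lemma d1_sub_sect a Z W x : sub_sect E Z -> sub_sect E W ->
  d1 (Theta a) Z W x = - th a (hbr Z W) x.
Proof.
move=> EZ EW; rewrite /d1.
have /(_ a) -> := (sub_sectP vb hE hTheta EZ.1).2 EZ.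
have /(_ a) -> := (sub_sectP vb hE hTheta EW.1).2 EW.
by rewrite !vf_act_cst !sub0r oppr0 add0r.
Qed.

Lemma involutive_of_structure_equations
    (Omega : 'I_k -> 'I_k -> lform (hF A) 1) :
  (forall a, form_eq (ext_d (Theta a))
     (fun z x => \sum_b wedge_form (Omega a b) (Theta b) z x)) ->
  involutive_ids E.
Proof.
move=> HO S T ES ET; have SST := hbr_smooth ES.1 ET.1.
apply/(sub_sectP vb hE hTheta SST) => a; apply/funext => x.
pose z (i : 'I_2) : sect (hF A) := if i == ord0 then S else T.
have Sz i : smooth_sect (z i) by rewrite /z; case: ifP => _; [case: ES|case: ET].
have := congr1 (@^~ x) (HO a z Sz); rewrite /= ext_d1E d1_sub_sect // big1.
  by move/eqP; rewrite oppr_eq0 => /eqP.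
move=> b _; rewrite wedge11E.
have /(_ b) -> := (sub_sectP vb hE hTheta ES.1).2 ES.
have /(_ b) -> := (sub_sectP vb hE hTheta ET.1).2 ET.
by rewrite !mulr0 subrr.
Qed.

Section Forms.
Context (z : 'I_k -> sect (hF A)).
Context (Sz : forall b, smooth_sect (z b)).
Context (Tz : forall a b, th a (z b) = fun=> (a == b)%:R).

Let Sth a Z (SZ : smooth_sect Z) : smooth_fun (th a Z) := form1_smooth (FTh a) SZ.

(** The component of [Z] in the complement of [E] spanned by the [z c]. *)
Definition vpart Z : sect (hF A) := fun x => \sum_c th c Z x *: z c x.

Lemma smooth_vpart Z : smooth_sect Z -> smooth_sect (vpart Z).
Proof. by move=> SZ; apply: smooth_sect_sum => // c; exact: Sth. Qed.

Lemma th_vpart a Z x : smooth_sect Z -> th a (vpart Z) x = th a Z x.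
Proof.
move=> SZ; rewrite /th (form1_sum vb) // => [|c]; last exact: Sth.
rewrite (bigD1 a) //= -/(th a (z a)) Tz eqxx mulr1 big1 ?addr0 // => c ca.
by rewrite -/(th a (z c)) Tz eq_sym (negbTE ca) mulr0.
Qed.

(* [Z + t * vpart Z]: the projection onto [E] for [t = -1]; for [t = -1/2] it
   splits evenly the part of [d Theta] quadratic in the [Theta b]. *)
Definition shear (t : R) Z : sect (hF A) :=
  fun x => cst 1 x *: Z x + cst t x *: vpart Z x.

Lemma smooth_shear t Z : smooth_sect Z -> smooth_sect (shear t Z).
Proof.
move=> SZ; apply: smooth_sectZD => //; [exact: smooth_fun_cst|exact: smooth_fun_cst|].
exact: smooth_vpart.
Qed.

Lemma shear_lin t (f g : M -> R) U V x : smooth_fun f -> smooth_fun g ->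
  smooth_sect U -> smooth_sect V ->
  shear t (fun y => f y *: U y + g y *: V y) x = f x *: shear t U x + g x *: shear t V x.
Proof.
move=> Sf Sg SU SV; rewrite /shear /cst /vpart !scale1r !scalerDr addrACA; congr (_ + _).
rewrite !(scalerA _ t) !(mulrC _ t) -!(scalerA t) -scalerDr; congr (_ *: _).
rewrite !scaler_sumr -big_split /=; apply: eq_bigr => c _.
by rewrite /th form1_lin // scalerDl !scalerA.
Qed.

Lemma sub_sect_shear Z : smooth_sect Z -> sub_sect E (shear (-1) Z).
Proof.
move=> SZ; apply/(sub_sectP vb hE hTheta (smooth_shear _ SZ)) => a; apply/funext => x.
rewrite /shear form1_lin //; [|exact: smooth_fun_cst|exact: smooth_fun_cst|exact: smooth_vpart].
by rewrite -/(th a (vpart Z)) -/(th a Z) th_vpart // /cst mul1r mulN1r subrr.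
Qed.

Lemma d1_shearl a t Z W x : smooth_sect Z -> smooth_sect W ->
  d1 (Theta a) (shear t Z) W x = d1 (Theta a) Z W x + t * d1 (Theta a) (vpart Z) W x.
Proof.
move=> SZ SW; have SV := smooth_vpart SZ.
have -> : shear t Z = fun x => cst t x *: vpart Z x + Z x.
  by apply: sect_ext => y; rewrite /shear scale1r addrC.
(* The index [rshift r a] only witnesses that the rank is positive. *)
by rewrite (d1_lin (rshift r a)) //; [rewrite addrC|exact: smooth_fun_cst].
Qed.

(** Recognizes the sums over [b] coming from the wedge products as values of [d1] on a component
    [vpart W]. *)
Lemma d1_vpartr a Z W x : smooth_sect Z -> smooth_sect W ->
  d1 (Theta a) Z (vpart W) x = \sum_b d1 (Theta a) Z (z b) x * th b W x.
Proof.
move=> SZ SW; rewrite d1C //; last exact: smooth_vpart.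
rewrite (d1_sum (rshift r a)) // -?sumrN => [|b]; last exact: Sth.
by apply: eq_bigr => b _; rewrite (d1C x (FTh a) SZ (Sz b)) mulNr mulrC.
Qed.

Definition connection_form a b : lform (hF A) 1 :=
  fun y => d1 (Theta a) (shear (- 2^-1) (y 0)) (z b).

Lemma connection_form_is_form a b : is_form (connection_form a b).
Proof.
split.
- by move=> y Sy; apply: (d1_smooth (rshift r a)) => //; exact: smooth_shear.
- move=> y c f g U V Sy Sf Sg SU SV; apply/funext => x.
  rewrite /connection_form /= (ord1 c) eqxx.
  have SSU := smooth_shear (- 2^-1) SU; have SSV := smooth_shear (- 2^-1) SV.
  (* The combination of two sections is written as a sum over booleans, to which [d1_sum]
     applies. *)
  pose s (i : bool) := if i then shear (- 2^-1) U else shear (- 2^-1) V.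
  pose h (i : bool) := if i then f else g.
  have -> : shear (- 2^-1) (fun x => f x *: U x + g x *: V x) =
      fun x => \sum_(i <- [:: true; false]) h i x *: s i x.
    by apply: sect_ext => y'; rewrite shear_lin // !big_cons big_nil addr0.
  by rewrite (d1_sum (rshift r a)) //; [rewrite !big_cons big_nil addr0|case|case].
- by move=> y c d _; rewrite (ord1 c) (ord1 d) eqxx.
Qed.

(** Write [D] for [d1 (Theta a)] and [V] for [vpart]. Involutivity gives [D(Z - VZ, W - VW) = 0],
    that is, [D(Z, W) = D(Z, VW) + D(VZ, W) - D(VZ, VW)]. The right-hand side of the equation is
    [D(Z - VZ/2, VW) - D(W - VW/2, VZ)], and its two halves of [D(VZ, VW)] add up to the same
    expression. *)
Lemma structure_equations a : involutive_ids E ->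
  form_eq (ext_d (Theta a))
    (fun y x => \sum_b wedge_form (connection_form a b) (Theta b) y x).
Proof.
move=> invE y Sy; apply/funext => x; rewrite ext_d1E.
set Z := y ord0; set W := y ord_max.
have SZ : smooth_sect Z by exact: Sy.
have SW : smooth_sect W by exact: Sy.
have SVZ := smooth_vpart SZ; have SVW := smooth_vpart SW.
have E0 : d1 (Theta a) (shear (-1) Z) (shear (-1) W) x = 0.
  have EZ := sub_sect_shear SZ; have EW := sub_sect_shear SW.
  rewrite d1_sub_sect // -[RHS]oppr0; congr (- _).
  have EZW := invE _ _ EZ EW.
  by rewrite /th ((sub_sectP vb hE hTheta EZW.1).2 EZW a).
have SsW := smooth_shear (-1) SW.
move: E0; rewrite d1_shearl // (d1C x (FTh a) SZ SsW) (d1C x (FTh a) SVZ SsW).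
rewrite !d1_shearl // => E0.
rewrite (eq_bigr (fun b => d1 (Theta a) (shear (- 2^-1) Z) (z b) x * th b W x
  - d1 (Theta a) (shear (- 2^-1) W) (z b) x * th b Z x)); last first.
  by move=> b _; rewrite wedge11E.
rewrite sumrB -!d1_vpartr //; [|exact: smooth_shear|exact: smooth_shear].
rewrite !d1_shearl //.
(* Antisymmetry reduces all terms to the four values [p1] to [p4], leaving a linear identity. *)
rewrite (d1C x (FTh a) SZ SW) (d1C x (FTh a) SZ SVW) (d1C x (FTh a) SVZ SVW).
move: E0; rewrite (d1C x (FTh a) SW SVZ).
set p1 := d1 _ W Z x; set p2 := d1 _ (vpart W) Z x.
set p3 := d1 _ (vpart Z) W x; set p4 := d1 _ (vpart W) (vpart Z) x.
by move=> E0; lra.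
Qed.

End Forms.

Lemma involutive_iff_structure_equations :
  involutive_ids E <->
  exists Omega : 'I_k -> 'I_k -> lform (hF A) 1,
    (forall a b, is_form (Omega a b)) /\
    (forall a, form_eq (ext_d (Theta a))
       (fun z x => \sum_(b < k) wedge_form (Omega a b) (Theta b) z x)).
Proof.
split=> [invE|[ Omega [_ HO]]]; last exact: involutive_of_structure_equations HO.
have [z [Sz Tz]] := dual_frame vb hE hTheta.
exists (connection_form z); split=> [a b|a]; first exact: connection_form_is_form.
exact: structure_equations.
Qed.

End StructureEquations.

(** The frame matrix at [x] has rank [r] and [p] columns. This excludes [p < r] as soon as [M] has a
    point. *)
Lemma subbundle_rank (R : realType) (m p r : nat) (M : manifold R m)
    (F : prebundle M p) (E : forall x, set (F x)) (x : M) :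
  vector_bundle F -> subbundle r E -> (r <= p)%N.
Proof.
move=> vb hE; have [i [U [S [_ _ /eqP Sr _ _]]]] := frame_coordinates vb x hE.
by move: (rank_leq_col (S x)); rewrite Sr.
Qed.

Theorem theorem4p2 (R : realType) (m n p r : nat)
    (M : manifold R m) (N : manifold R n) (A : gen_lie_algebroid M N p)
    (E : forall x, set (hF A x)) (hE : subbundle r E)
    (Theta : 'I_(p - r) -> lform (hF A) 1)
    (hTheta : form_base (annihilator E) Theta) :
  involutive_ids E <->
  exists Omega : 'I_(p - r) -> 'I_(p - r) -> lform (hF A) 1,
    (forall alpha beta, is_form (Omega alpha beta)) /\
    (forall alpha, form_eq (ext_d (Theta alpha))
       (fun z x => \sum_(beta < p - r)
                     wedge_form (Omega alpha beta) (Theta beta) z x)%R).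
Proof.
have [rp|pr] := leqP r p.
  have e : p = (r + (p - r))%N by rewrite subnKC.
  (* The difference is generalized to [k], so that [p] can be replaced by [r + k], the shape
     required by the block matrices. *)
  move: (p - r)%N e Theta hTheta => k e; subst p => Theta hTheta.
  exact: involutive_iff_structure_equations.
(* In this case [M] is empty. *)
have nM (x : M) : False.
  by have := subbundle_rank x (vector_bundle_hF A) hE; rewrite leqNgt pr.
(* Truncated subtraction gives [p - r = 0], so [Omega] is indexed by an empty type. *)
have n0 (a : 'I_(p - r)) : False.
  by case: a => a; rewrite (eqP (ltnW pr : p - r == 0)%N).
split=> [_|_ S T [SS _] [ST _]]; last by split=> [|x]; [exact: hbr_smooth|case: (nM x)].
by exists (fun a => False_rect _ (n0 a)); split=> a; case: (n0 a).
Qed.
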